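(* Let $\theta\in(0,1]$, $\Delta t>0$. Suppose that the mesh $\mathcal{T}_h$ satisfies the anisotropic nonobtuse angle condition $$0<\widetilde{\alpha}_{ij}^K\le\frac{\pi}{2},\qquad \forall\, i,j=1,\dots,d+1,\ i\ne j,\ \forall K\in\mathcal{T}_h,$$ and that the time step size satisfies $$\Delta t\ \le\ \frac{1}{(1-\theta)(d+1)}\min_{K\in\mathcal{T}_h}\ \min_{i=1,\dots,d+1}\frac{(h_i^K)^2}{\lambda_{\max}(\mathbb{D}_K)}.$$ Then the lumped-mass scheme $$\left(\begin{bmatrix}\bar M_{11}&0\\0&I\end{bmatrix}+\theta\Delta t\begin{bmatrix}A_{11}&A_{12}\\0&0\end{bmatrix}\right)\boldsymbol{u}^{n+1}=\left(\begin{bmatrix}\bar M_{11}&0\\0&0\end{bmatrix}-(1-\theta)\Delta t\begin{bmatrix}A_{11}&A_{12}\\0&0\end{bmatrix}\right)\boldsymbol{u}^n+\Delta t\,\boldsymbol{f}^{n+\theta},\quad n=0,\dots,N-1,$$ with $\boldsymbol{u}^0=(u_0(\boldsymbol{a}_1),\dots,u_0(\boldsymbol{a}_{N_v}))^T$, satisfies a discrete maximum principle: whenever $f(\boldsymbol{x},t)\le 0$ in $\Omega_T$, its solution satisfies $$\max_{n=0,\dots,N}\ \max_{\boldsymbol{x}\in\overline{\Omega}}U^n(\boldsymbol{x})\ =\ \max\Big\{0,\ \max_{n=1,\dots,N}\ \max_{\boldsymbol{x}\in\partial\Omega}U^n(\boldsymbol{x}),\ \max_{\boldsymbol{x}\in\overline{\Omega}}U^0(\boldsymbol{x})\Big\},$$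 where $U^n(\boldsymbol{x})=\sum_{j=1}^{N_v}u_j^n\phi_j(\boldsymbol{x})$.
   Context: Problem. $\Omega\subset\mathbb{R}^d$ ($d\ge1$) is a connected polygonal or polyhedral domain, $T>0$, $\Omega_T=\Omega\times(0,T]$. The problem being discretized is $u_t-\nabla\cdot(\mathbb{D}\nabla u)=f(\boldsymbol{x},t)$ in $\Omega_T$, $u=g(\boldsymbol{x},t)$ on $\partial\Omega\times[0,T]$, $u(\boldsymbol{x},0)=u_0(\boldsymbol{x})$ in $\Omega$, with given functions $f,g,u_0$ and a symmetric, strictly positive definite matrix-valued function $\mathbb{D}=\mathbb{D}(\boldsymbol{x})$ independent of time. Data are assumed regular enough that the integrals and point values below make sense. Mesh. $\mathcal{T}_h$ is a (conforming) simplicial triangulation of $\Omega$ with vertices $\boldsymbol{a}_1,\dots,\boldsymbol{a}_{N_v}$, ordered so that the first $N_{vi}$ are the interior vertices (the others lie on $\partial\Omega$). $\phi_j$ is the continuous piecewise linear basis function associated with $\boldsymbol{a}_j$. $|K|$ is the volume of $K$ and $\mathbb{D}_K=\frac1{|K|}\int_K\mathbb{D}\,d\boldsymbol{x}$; $\lambda_{\max}(\mathbb{D}_K)$ is its largest eigenvalue. Geometry. For $K\in\mathcal{T}_h$ with vertices $\boldsymbol{a}_1^K,\dots,\boldsymbol{a}_{d+1}^K$, $S_i^K$ is the face opposite $\boldsymbol{a}_i^K$, $\boldsymbol{n}_i^K$ its unit normal pointing to $\boldsymbol{a}_i^K$, $h_i^K$ the distance from $\boldsymbol{a}_i^K$ to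 $S_i^K$, and $\boldsymbol{q}_i^K=\boldsymbol{n}_i^K/h_i^K$. For $i\ne j$, $\widetilde\alpha_{ij}^K\in[0,\pi]$ is the dihedral angle between the faces $\mathbb{D}_K^{-1/2}S_i^K$ and $\mathbb{D}_K^{-1/2}S_j^K$ of $\mathbb{D}_K^{-1/2}K$ (i.e. the angle of $K$ in the metric $\mathbb{D}_K^{-1}$), given by $$\cos(\widetilde\alpha_{ij}^K)=-\frac{(\boldsymbol{q}_i^K)^T\mathbb{D}_K\boldsymbol{q}_j^K}{\|\boldsymbol{q}_i^K\|_{\mathbb{D}_K}\|\boldsymbol{q}_j^K\|_{\mathbb{D}_K}},\qquad \|\boldsymbol{q}\|_{\mathbb{D}_K}=\sqrt{\boldsymbol{q}^T\mathbb{D}_K\boldsymbol{q}}.$$ Scheme ($\theta$-method in time, linear finite elements with lumped mass in space). For $i=1,\dots,N_{vi}$, $j=1,\dots,N_v$ let $$m_{ij}=\sum_{K\in\mathcal{T}_h}\int_K\phi_j\phi_i\,d\boldsymbol{x},\qquad a_{ij}=\sum_{K\in\mathcal{T}_h}|K|(\nabla\phi_i|_K)^T\mathbb{D}_K\nabla\phi_j|_K,$$ $f_i(t)=\sum_{K}\int_K f(\boldsymbol{x},t)\phi_i\,d\boldsymbol{x}$; $[A_{11}\ A_{12}]=(a_{ij})$, partitioned by columns $1,\dots,N_{vi}$ and $N_{vi}+1,\dots,N_v$; $\bar M_{11}$ is the $N_{vi}\times N_{vi}$ diagonal (lumped mass) matrix with diagonal entries $\bar m_{ii}=\sum_{j=1}^{N_v}m_{ij}$;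 $I$ is the identity matrix of size $N_v-N_{vi}$; and $$\boldsymbol{f}^{n+\theta}=\Big(f_1(t_n+\theta\Delta t),\dots,f_{N_{vi}}(t_n+\theta\Delta t),\tfrac1{\Delta t}g(\boldsymbol{a}_{N_{vi}+1},t_{n+1}),\dots,\tfrac1{\Delta t}g(\boldsymbol{a}_{N_v},t_{n+1})\Big)^T,$$ where $t_n=n\Delta t$, $N\ge1$ is the number of time steps, $N\Delta t\le T$, and $\boldsymbol{u}^n=(u_1^n,\dots,u_{N_v}^n)^T$. Convention. When $\theta=1$ the upper bound on $\Delta t$ is $+\infty$, i.e. no constraint.
   Formalization: The printed equality fails when all boundary and initial values are negative (u_0 = g = -1, f = 0 gives -1 = 0); it is proved when the larger of the boundary and initial maxima is at least 0, and in general with ≤ in place of =. *)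

(* Defs.v *)
From HB Require Import structures.
From mathcomp Require Import all_boot all_order all_algebra.
From mathcomp Require Import all_classical all_reals all_analysis.

Set Implicit Arguments.
Unset Strict Implicit.
Unset Printing Implicit Defensive.

Import Order.TTheory GRing.Theory Num.Theory.
Import numFieldNormedType.Exports.

Local Open Scope classical_set_scope.
Local Open Scope ring_scope.

Section rV_measurable.
Variables (R : realType) (n : nat).

Let coors (i : 'I_n) (x : 'rV[R]_n) : measurableTypeR R := x ord0 i.

Let rV_set0 : g_sigma_preimage coors set0.
Proof. exact: sigma_algebra0. Qed.

Let rV_setC A : g_sigma_preimage coors A -> g_sigma_preimage coors (~` A).
Proof. exact: sigma_algebraC. Qed.

Let rV_bigcup (F : _^nat) : (forall i, g_sigma_preimage coors (F i)) ->
  g_sigma_preimage coors (\bigcup_i (F i)).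
Proof. exact: sigma_algebra_bigcup. Qed.

(* The Borel sigma-algebra of R^n, as the product of n copies of that of R. *)
HB.instance Definition _ := @isMeasurable.Build 
  (measure_tuple_display (R.-ocitv.-measurable.-sigma)%mdisp)
  'rV[R]_n (g_sigma_preimage coors) rV_set0 rV_setC rV_bigcup.

Lemma measurable_rV_coord (i : 'I_n) : measurable_fun [set: 'rV[R]_n] (coors i).
Proof.
move=> _ Y mY; rewrite setTI; apply: sub_sigma_algebra => /=.
rewrite -bigcup_seq/=; exists i => /=; first by rewrite mem_index_enum.
by exists Y => //; rewrite setTI.
Qed.

Lemma measurable_fun_rVP d (T : measurableType d) (f : T -> 'rV[R]_n) :
  (forall i, measurable_fun [set: T] (coors i \o f)) ->
  measurable_fun [set: T] f.
Proof.
move=> mf; suff : g_sigma_preimage (fun i => coors i \o f) `<=` measurable.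
  rewrite g_sigma_preimage_comp => prefS _ A mA; apply: prefS.
  by exists A.
apply: smallest_sub; first exact: sigma_algebra_measurable.
rewrite -bigcup_seq/=; apply: bigcup_sub => i _ A [B mB <-].
exact: mf.
Qed.

End rV_measurable.

Lemma sigma_finite_measure_ex d (T : measurableType d) (R : realType)
    (m : set T -> \bar R) :
  m set0 = 0%E -> (forall A, (0 <= m A)%E) -> semi_sigma_additive m ->
  sigma_finite setT m -> exists mu : {sigma_finite_measure set T -> \bar R}, m = mu.
Proof.
move=> m0 mge0 madd mfin.
pose mu1 : {measure set T -> \bar R} :=
  HB.pack m (isMeasure.Build _ _ _ m m0 mge0 madd).
pose mu2 : {sigma_finite_measure set T -> \bar R} :=
  HB.pack m (isMeasure.Build _ _ _ m m0 mge0 madd)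
    (Measure_isSigmaFinite.Build _ _ _ mu1 mfin).
by exists mu2.
Qed.

Section lebesgue_rV.
Variable R : realType.
Local Open Scope ereal_scope.

Definition cons_rV m (p : measurableTypeR R * 'rV[R]_m) : 'rV[R]_m.+1 :=
  row_mx ((p.1 : R)%:M : 'rV[R]_1) p.2.

Lemma measurable_cons_rV m : measurable_fun setT (@cons_rV m).
Proof.
apply: measurable_fun_rVP => i.
have [j ij|j ij] := split_ordP (i : 'I_(1 + m)).
- rewrite (_ : _ \o _ = fst); first exact: measurable_fst.
  apply/funext => p /=; rewrite ij [LHS](@row_mxEl _ 1 1 m).
  by rewrite (ord1 j) mxE eqxx mulr1n.
- rewrite (_ : _ \o _ = (fun x : 'rV[R]_m => x ord0 j : measurableTypeR R) \o snd).
    by apply: measurableT_comp; [exact: measurable_rV_coord|exact: measurable_snd].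
  by apply/funext => p /=; rewrite ij [LHS](@row_mxEr _ 1 1 m).
Qed.

(* The Lebesgue measure of R^n, as an n-fold product measure. *)
Fixpoint lebesgue_rV n : set 'rV[R]_n -> \bar R :=
  match n with
  | 0 => \d_(0%R : 'rV[R]_0)
  | m.+1 => pushforward (lebesgue_measure \x @lebesgue_rV m) (@cons_rV m)
  end.

Lemma lebesgue_rV_measure n :
  exists mu : {sigma_finite_measure set 'rV[R]_n -> \bar R},
    @lebesgue_rV n = mu.
Proof.
elim: n => [|m [mu mE]] /=; first by exists (\d_(0%R : 'rV[R]_0)).
rewrite mE.
pose nu : {measure set (measurableTypeR R * 'rV[R]_m)%type -> \bar R} :=
  lebesgue_measure \x mu.
pose pm := pushforward nu (@cons_rV m).
have mc := @measurable_cons_rV m.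
have p0 : pm set0 = 0 by rewrite /pm /pushforward preimage_set0 measure0.
have p1 : forall A, 0 <= pm A by move=> A; exact: measure_ge0.
have p2 : semi_sigma_additive pm.
  move=> F mF tF mUF; rewrite /pm /pushforward preimage_bigcup.
  apply: measure_semi_sigma_additive.
  - by move=> n; rewrite -[X in measurable X]setTI; exact: mc.
  - apply/trivIsetP => /= i j _ _ ij; rewrite -preimage_setI.
    by move/trivIsetP : tF => /(_ _ _ _ _ ij) ->//; rewrite preimage_set0.
  - by rewrite -preimage_bigcup -[X in measurable X]setTI; exact: mc.
have p3 : sigma_finite setT pm.
  have [G TG Goo] : sigma_finite setT nu.
    have /sigma_finiteP[F [TF ndF Foo]] := sigma_finiteT (@lebesgue_measure R).
    have /sigma_finiteP[G [TG ndG Goo]] := sigma_finiteT mu.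
    exists (fun n => F n `*` G n).
      rewrite -setXTT TF TG predeqE => -[x y]; split.
        move=> [/= [n _ Fnx] [k _ Gky]]; exists (maxn n k) => //; split.
        - by move: x Fnx; exact/subsetPset/ndF/leq_maxl.
        - by move: y Gky; exact/subsetPset/ndG/leq_maxr.
      by move=> [n _ []/= ? ?]; split; exists n.
    move=> k; have [? ?] := Foo k; have [? ?] := Goo k.
    split; first exact: measurableX.
    by rewrite /nu/= product_measure1E// lte_mul_pinfty// ge0_fin_numE.
  have cK : injective (@cons_rV m).
    move=> [x v] [y w] /(@eq_row_mx _ 1 1 m) [/= /matrixP/(_ ord0 ord0)].
    by rewrite !mxE !eqxx !mulr1n => -> ->.
  have uncons (v : 'rV[R]_m.+1) :
      @cons_rV m (lsubmx (v : 'rV_(1 + m)) ord0 ord0, rsubmx (v : 'rV_(1 + m))) = v.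
    rewrite /cons_rV/= -mx11_scalar; exact: (@hsubmxK _ 1 1 m).
  pose g (v : 'rV[R]_m.+1) : measurableTypeR R * 'rV[R]_m :=
    (lsubmx (v : 'rV_(1 + m)) ord0 ord0, rsubmx (v : 'rV_(1 + m))).
  have mg : measurable_fun setT g.
    apply/measurable_fun_pairP; split.
      rewrite (_ : _ \o _ = fun v : 'rV[R]_m.+1 =>
        v ord0 (lshift m (ord0 : 'I_1)) : measurableTypeR R).
        exact: measurable_rV_coord.
      by apply/funext => v /=; rewrite mxE.
    apply: measurable_fun_rVP => i.
    rewrite (_ : _ \o _ = fun v : 'rV[R]_m.+1 =>
        v ord0 (rshift 1 i) : measurableTypeR R).
      exact: measurable_rV_coord.
    by apply/funext => v /=; rewrite mxE.
  exists (fun k => g @^-1` G k).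
    by rewrite -preimage_bigcup -TG preimage_setT.
  move=> k; have [mGk Gk] := Goo k; split.
    by rewrite -[X in measurable X]setTI; exact: mg.
  rewrite /pm /pushforward (_ : _ @^-1` _ = G k)//.
  apply/seteqP; split => p /=; rewrite (_ : g (cons_rV p) = p)//;
  by apply: cK; exact: uncons.
exact: sigma_finite_measure_ex p0 p1 p2 p3.
Qed.


Lemma lebesgue_rV_set0 n : @lebesgue_rV n set0 = 0.
Proof. by have [mu ->] := lebesgue_rV_measure n; exact: measure0. Qed.

Lemma lebesgue_rV_ge0 n A : 0 <= @lebesgue_rV n A.
Proof. by have [mu ->] := lebesgue_rV_measure n; exact: measure_ge0. Qed.

Lemma lebesgue_rV_semi_sigma_additive n : semi_sigma_additive (@lebesgue_rV n).
Proof.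
by have [mu ->] := lebesgue_rV_measure n; exact: measure_semi_sigma_additive.
Qed.

HB.instance Definition _ n := isMeasure.Build _ _ _ (@lebesgue_rV n)
  (lebesgue_rV_set0 n) (@lebesgue_rV_ge0 n) (@lebesgue_rV_semi_sigma_additive n).

Lemma lebesgue_rV_sigma_finite n : sigma_finite setT (@lebesgue_rV n).
Proof. by have [mu ->] := lebesgue_rV_measure n; exact: sigma_finiteT. Qed.

HB.instance Definition _ n := Measure_isSigmaFinite.Build _ _ _ (@lebesgue_rV n)
  (@lebesgue_rV_sigma_finite n).

End lebesgue_rV.

Notation leb := (@lebesgue_rV _ _).

Section euclidean.
Variables (R : realType) (d : nat).
Implicit Types (A : 'M[R]_d) (p q : 'rV[R]_d).

(* Points and vectors of R^d are row vectors, so the p^T A q of column vectors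
   is p *m A *m q^T. *)
Definition form A p q : R := (p *m A *m q^T) ord0 ord0.
Definition form_norm A p : R := Num.sqrt (form A p p).
Definition dot p q : R := (p *m q^T) ord0 ord0.
Definition euclid_norm p : R := Num.sqrt (dot p p).

Definition pos_def A := forall v : 'rV[R]_d, v != 0 -> 0 < form A v v.
Definition lambda_max A : R := sup [set l | eigenvalue A l].

Definition grad (phi : 'rV[R]_d -> R) (x : 'rV[R]_d) : 'rV[R]_d :=
  \row_k 'D_(delta_mx ord0 k) phi x.

Definition boundary (X : set 'rV[R]_d) := closure X `\` X°.

Definition is_max (X : set R) (m : R) := X m /\ ubound X m.

Section hulls.
Variables (n : nat) (a : 'I_n -> 'rV[R]_d).

Definition aff_hull (K : {set 'I_n}) : set 'rV[R]_d :=
  [set x | exists2 w : 'I_n -> R, \sum_(i in K) w i = 1 &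
     x = \sum_(i in K) w i *: a i].

Definition conv_hull (K : {set 'I_n}) : set 'rV[R]_d :=
  [set x | exists w : 'I_n -> R,
     [/\ forall i, 0 <= w i, \sum_(i in K) w i = 1 &
         x = \sum_(i in K) w i *: a i]].

Definition aff_indep (K : {set 'I_n}) := forall w : 'I_n -> R,
  \sum_(i in K) w i = 0 -> \sum_(i in K) w i *: a i = 0 ->
  forall i, i \in K -> w i = 0.
End hulls.

(* A bounded domain whose boundary is made of finitely many
   (d-1)-dimensional simplices. *)
Definition polyhedral_domain (Omega : set 'rV[R]_d) :=
  [/\ open Omega, connected Omega, Omega !=set0, bounded_set Omega &
      exists m (F : 'I_m -> 'I_d -> 'rV[R]_d),
        boundary Omega = \bigcup_k conv_hull (F k) [set: 'I_d]].
End euclidean.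

Section mesh.
Variables (R : realType) (d ni nb : nat).
(* The first [ni] vertices are the interior ones, the other [nb] lie on the
   boundary. *)
Local Notation vertex := 'I_(ni + nb).
Variables (Omega : set 'rV[R]_d) (a : vertex -> 'rV[R]_d).
Implicit Types (K L : {set vertex}) (i j : vertex).

(* A simplex is given by the set [K] of its vertices; [conv_hull a K] is the
   corresponding set of points. *)
Record triangulation (T : {set {set vertex}}) : Prop := Triangulation {
  tri_card : forall K, K \in T -> #|K| = d.+1;
  tri_indep : forall K, K \in T -> aff_indep a K;
  tri_conforming : forall K L, K \in T -> L \in T ->
    conv_hull a K `&` conv_hull a L = conv_hull a (K :&: L);
  tri_cover : closure Omega = \bigcup_(K in [set` T]) conv_hull a K;
  tri_interior : forall K, K \in T -> (conv_hull a K)° `<=` Omega;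
  tri_vertices : forall i, exists2 K, K \in T & i \in K;
  tri_interior_vertices : forall i : 'I_ni, Omega (a (lshift nb i));
  tri_boundary_vertices : forall i : 'I_nb, boundary Omega (a (rshift ni i)) }.

Definition nodal_basis (T : {set {set vertex}})
    (phi : vertex -> 'rV[R]_d -> R) :=
  forall j,
    [/\ {within closure Omega, continuous (phi j)},
        forall K, K \in T -> exists (g : 'rV[R]_d) (c : R),
          forall x, conv_hull a K x -> phi j x = dot g x + c &
        forall i, phi j (a i) = (i == j)%:R].

Definition vol K : R := fine (leb (conv_hull a K)).

Definition mean_mx (D : 'rV[R]_d -> 'M[R]_d) K : 'M[R]_d :=
  (vol K)^-1 *: \matrix_(k, l) \int[leb]_(x in conv_hull a K) D x k l.

(* The gradient of a function that is affine on [K], read off at the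
   barycentre, an interior point of [K]. *)
Definition grad_on K (phi : 'rV[R]_d -> R) : 'rV[R]_d :=
  grad phi (d.+1%:R^-1 *: \sum_(i in K) a i).

(* Unit normal of the face opposite to [a i], pointing to [a i]. *)
Definition is_unit_normal K i (n : 'rV[R]_d) :=
  [/\ euclid_norm n = 1,
      forall j l, j \in K :\ i -> l \in K :\ i -> dot n (a j - a l) = 0 &
      forall j, j \in K :\ i -> 0 < dot n (a i - a j)].

Definition unit_normal K i : 'rV[R]_d := get [set n | is_unit_normal K i n].

(* Altitude: the distance is to the hyperplane spanned by the opposite face,
   so that [qvec K i] is the gradient on [K] of the basis function at [a i]. *)
Definition height K i : R :=
  inf [set euclid_norm (a i - y) | y in aff_hull a (K :\ i)].

Definition qvec K i : 'rV[R]_d := (height K i)^-1 *: unit_normal K i.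

Definition dihedral (D : 'rV[R]_d -> 'M[R]_d) K i j : R :=
  let DK := mean_mx D K in
  acos (- (form DK (qvec K i) (qvec K j) /
           (form_norm DK (qvec K i) * form_norm DK (qvec K j)))).

Section scheme.
Variables (T : {set {set vertex}}) (phi : vertex -> 'rV[R]_d -> R).

Definition mass i j : R :=
  \sum_(K in T) \int[leb]_(x in conv_hull a K) (phi j x * phi i x).

Definition stiff (D : 'rV[R]_d -> 'M[R]_d) i j : R :=
  \sum_(K in T)
    vol K * form (mean_mx D K) (grad_on K (phi i)) (grad_on K (phi j)).

Definition load (f : 'rV[R]_d -> R -> R) i (t : R) : R :=
  \sum_(K in T) \int[leb]_(x in conv_hull a K) (f x t * phi i x).

Definition lumped_mass : 'M[R]_ni :=
  diag_mx (\row_i \sum_j mass (lshift nb i) j).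

Definition stiff11 D : 'M[R]_ni :=
  \matrix_(i, j) stiff D (lshift nb i) (lshift nb j).

Definition stiff12 D : 'M[R]_(ni, nb) :=
  \matrix_(i, j) stiff D (lshift nb i) (rshift ni j).

Definition rhs (f g : 'rV[R]_d -> R -> R) (theta dt : R) (n : nat) :
    'cV[R]_(ni + nb) :=
  col_mx (\col_i load f (lshift nb i) (n%:R * dt + theta * dt))
         (\col_j (dt^-1 * g (a (rshift ni j)) (n.+1%:R * dt))).

Definition fe_fun (u : 'cV[R]_(ni + nb)) (x : 'rV[R]_d) : R :=
  \sum_j u j ord0 * phi j x.
End scheme.
End mesh.

(* Main.v *)
(* On a simplex K the basis functions are the barycentric coordinates, and
   their gradients are the vectors q_i^K. The angle condition therefore makes
   the off-diagonal stiffness entries nonpositive, and the stiffness rows sum to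
   zero because the basis functions sum to one. Since |q_i^K| = 1 / h_i^K and
   the integral of a barycentric coordinate over K is |K| / (d + 1), the bound
   on the time step makes the diagonal of the explicit part nonnegative. Hence
   at an interior node where u^{n+1} is maximal, its value is at most a convex
   combination of the entries of u^n.

   The integral of a barycentric coordinate comes from symmetry: the affine map
   that swaps two vertices of K is an involution, and a Fubini argument shows
   that it preserves the Lebesgue measure because it preserves K. *)

From HB Require Import structures.
Require Import Defs.
From mathcomp Require Import all_boot all_order all_algebra.
From mathcomp Require Import all_classical all_reals all_analysis.
From mathcomp Require Import measurable_realfun ring lra.

Set Implicit Arguments.
Unset Strict Implicit.
Unset Printing Implicit Defensive.

Import Order.TTheory GRing.Theory Num.Theory.
Import numFieldNormedType.Exports.

Local Open Scope classical_set_scope.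
Local Open Scope ring_scope.

(* all_algebra shadows [form] with sesquilinear forms. *)
Local Notation form := Defs.form.

(** No Jacobian is computed. The Fubini identity for an involution compares products of two
    measures, so on its own it fixes the measure of a preimage only up to a factor independent of
    the set. Testing it on [K], which has positive finite measure and is its own preimage, shows
    that the factor is 1. [D] and [f] are controlled only on the open set [Omega], whereas a simplex
    may touch the boundary. Symmetry, definiteness and signs therefore hold on [K] only almost
    everywhere, the faces being null sets. Barycentric coordinates are not built from the vertices:
    they are the affine pieces of the nodal basis. Their values at the vertices and the count
    [#|K| = d.+1] yield normals, altitudes, volume bounds and gradients. *)

Section dot.
Variables (R : realType) (d : nat).
Implicit Types (p q v w x y : 'rV[R]_d).

Lemma dotE p q : dot p q = \sum_i p ord0 i * q ord0 i.
Proof. by rewrite /dot mxE; apply: eq_bigr => i _; rewrite mxE. Qed.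

Lemma dotC p q : dot p q = dot q p.
Proof. by rewrite !dotE; apply: eq_bigr => i _; rewrite mulrC. Qed.

Lemma dotDr q x y : dot q (x + y) = dot q x + dot q y.
Proof. by rewrite !dotE -big_split; apply: eq_bigr => i _; rewrite mxE mulrDr. Qed.

Lemma dotZr (k : R) q x : dot q (k *: x) = k * dot q x.
Proof. by rewrite !dotE big_distrr; apply: eq_bigr => i _; rewrite mxE mulrCA. Qed.

Lemma dotNr q x : dot q (- x) = - dot q x.
Proof. by rewrite -scaleN1r dotZr mulN1r. Qed.

Lemma dotBr q x y : dot q (x - y) = dot q x - dot q y.
Proof. by rewrite dotDr dotNr. Qed.

Lemma dotBl p q x : dot (p - q) x = dot p x - dot q x.
Proof. by rewrite !(dotC _ x) dotBr. Qed.

Lemma dotZl k q x : dot (k *: q) x = k * dot q x.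
Proof. by rewrite !(dotC _ x) dotZr. Qed.

Lemma dot0r q : dot q 0 = 0.
Proof. by rewrite -(scale0r 0) dotZr mul0r. Qed.

Lemma dot_sumr (I : finType) (P : pred I) (F : I -> 'rV[R]_d) q :
  dot q (\sum_(i | P i) F i) = \sum_(i | P i) dot q (F i).
Proof.
by elim/big_ind2 : _ => [|x ? y ? <- <-|//]; [exact: dot0r|exact: dotDr].
Qed.

Lemma affine_sum (I : finType) (P : pred I) (w : I -> R) (F : I -> 'rV[R]_d) q c :
  \sum_(i | P i) w i = 1 ->
  dot q (\sum_(i | P i) w i *: F i) + c = \sum_(i | P i) w i * (dot q (F i) + c).
Proof.
move=> w1; rewrite dot_sumr; under [RHS]eq_bigr do rewrite mulrDr.
rewrite big_split -mulr_suml w1 mul1r; congr (_ + _).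
by apply: eq_bigr => i _; rewrite dotZr.
Qed.

Lemma dot_ge0 v : 0 <= dot v v.
Proof. by rewrite dotE sumr_ge0// => k _; rewrite -expr2 sqr_ge0. Qed.

Lemma dot_gt0 q : q != 0 -> 0 < dot q q.
Proof.
move=> q0; rewrite lt_neqAle; apply/andP; split; last first.
  by rewrite dotE sumr_ge0// => i _; rewrite -expr2 sqr_ge0.
apply: contra_neq q0 => /esym; rewrite dotE => /psumr_eq0P H.
apply/rowP => i; rewrite mxE; apply/eqP; rewrite -[_ == 0]orbb -mulf_eq0.
by apply/eqP/H => // j _; rewrite -expr2 sqr_ge0.
Qed.

Lemma dot_eq0 v : (forall w, dot v w = 0) -> v = 0.
Proof.
by move=> /(_ v) v0; apply/eqP/negPn/negP => /dot_gt0; rewrite v0 ltxx.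
Qed.

End dot.

(** * Lebesgue measure on row vectors *)

(** The translated measure is a pushforward that gives half-open intervals their length, and these
    intervals determine Lebesgue measure. *)
Lemma lebesgue_measure_translation (R : realType) (t : R)
    (A : set (measurableTypeR R)) : measurable A ->
  lebesgue_measure [set x : measurableTypeR R | A (x + t)] = lebesgue_measure A.
Proof.
move=> mA.
have mt : measurable_fun setT (fun x : measurableTypeR R => x + t : measurableTypeR R).
  exact: measurable_funD.
pose f : {mfun measurableTypeR R >-> measurableTypeR R} :=
  HB.pack (fun x : measurableTypeR R => x + t : measurableTypeR R)
          (isMeasurableFun.Build _ _ _ _ _ mt).
apply/esym/(@lebesgue_measure_unique R (pushforward lebesgue_measure f)) => // X.
case=> -[l r] /= _ <-.
rewrite /pushforward.
have -> : f @^-1` `]l, r] = `]l - t, r - t]%classic.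
  by apply/seteqP; split => x /=; rewrite !in_itv/= ltrBlDr lerBrDr.
rewrite [LHS]lebesgue_measure_itv [RHS]lebesgue_measure_itv /= !lte_fin ltrD2r.
by case: ifP => // _; rewrite -!EFinB; congr (_ %:E); ring.
Qed.

(** Tonelli's theorem for the indicator of [E]. The involution and hyperplane lemmas below each
    amount to a choice of [E]. *)
Lemma measure_sections d1 d2 (T1 : measurableType d1) (T2 : measurableType d2)
    (R : realType) (m1 : {sigma_finite_measure set T1 -> \bar R})
    (m2 : {sigma_finite_measure set T2 -> \bar R}) (E : set (T1 * T2)) :
  measurable E ->
  (\int[m1]_x m2 [set y | E (x, y)] = \int[m2]_y m1 [set x | E (x, y)])%E.
Proof.
move=> mE.
have mi : measurable_fun setT (EFin \o \1_E : T1 * T2 -> \bar R).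
  by apply/measurable_EFinP; exact: measurable_indic.
have := @fubini_tonelli _ _ T1 T2 R m1 m2 (EFin \o \1_E) mi.
have i0 : forall z, (0 <= (EFin \o \1_E : _ -> \bar R) z)%E.
  by move=> z /=; rewrite lee_fin.
move=> /(_ i0) H.
transitivity (\int[m1]_x \int[m2]_y (EFin \o \1_E) (x, y))%E.
  apply: eq_integral => x _.
  rewrite -[in LHS](setIT [set y | E (x, y)]) -integral_indic//; last first.
    by have := measurable_xsection x mE; rewrite xsectionE.
rewrite H; apply: eq_integral => y _.
rewrite -[in RHS](setIT [set x | E (x, y)]) -integral_indic//.
by have := measurable_ysection y mE; rewrite ysectionE.
Qed.

Section translation.
Variable R : realType.

Lemma measurable_cons_rVP n (A : set 'rV[R]_n.+1) :
  measurable A -> measurable ((@cons_rV R n) @^-1` A).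
Proof.
by move=> mA; rewrite -[X in measurable X]setTI; exact: measurable_cons_rV.
Qed.

Lemma cons_rVD n (x y : R) (v w : 'rV[R]_n) :
  cons_rV (x, v) + cons_rV (y, w) = cons_rV (x + y, v + w).
Proof. by rewrite /cons_rV /= raddfD; exact: (@add_row_mx R 1 1 n). Qed.

Lemma cons_rVK n (v : 'rV[R]_n.+1) :
  cons_rV (lsubmx (v : 'rV_(1 + n)) ord0 ord0, rsubmx (v : 'rV_(1 + n))) = v.
Proof. by rewrite /cons_rV/= -mx11_scalar; exact: (@hsubmxK _ 1 1 n). Qed.

(** Induction along the product construction of the measure: the tail of [t] is absorbed in each
    slice by the induction hypothesis, its head by invariance on the line. *)
Lemma lebesgue_rV_translation n (t : 'rV[R]_n) (A : set 'rV[R]_n) :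
  measurable A -> leb [set x | A (x + t)] = leb A.
Proof.
elim: n t A => [|n IH] t A mA.
  by congr leb; apply/funext => x /=; rewrite [t]thinmx0 addr0.
rewrite -{1}(cons_rVK t); set s := lsubmx _ _ _; set v := rsubmx _.
have mB := measurable_cons_rVP mA.
set B := _ @^-1` A in mB.
rewrite /lebesgue_rV/= -/(@lebesgue_rV R n) /pushforward /product_measure1.
transitivity (\int[lebesgue_measure]_x leb [set w | B ((x + s)%R, w)])%E.
  apply: eq_integral => x _ /=.
  rewrite -(IH v [set w | B (x + s, w)]); last first.
    by have := measurable_xsection (x + s) mB; rewrite xsectionE.
  rewrite xsectionE /=; congr leb; apply/funext => w /=.
  by rewrite cons_rVD.
have mg : measurable_fun setT (fun x : measurableTypeR R => leb [set w | B (x, w)]).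
  have := @measurable_fun_xsection _ _ (measurableTypeR R) _ R (@lebesgue_rV R n) B mB.
  by congr measurable_fun; apply/funext => x /=; rewrite xsectionE.
have ms : measurable_fun setT (fun x : measurableTypeR R => x + s : measurableTypeR R).
  exact: measurable_funD.
pose f : {mfun measurableTypeR R >-> measurableTypeR R} :=
  HB.pack (fun x : measurableTypeR R => x + s : measurableTypeR R)
          (isMeasurableFun.Build _ _ _ _ _ ms).
transitivity (\int[pushforward lebesgue_measure f]_x leb [set w | B (x, w)])%E.
  by rewrite (@ge0_integral_pushforward _ _ _ _ _ _ ms (@lebesgue_measure R)).
transitivity (\int[lebesgue_measure]_(x in [set: measurableTypeR R])
    leb [set w | B (x, w)])%E.
  apply: eq_measure_integral => X mX _; exact: lebesgue_measure_translation.
by apply: eq_integral => x _ /=; rewrite xsectionE.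
Qed.

Lemma measurable_fun_rVD d (T : measurableType d) n (f g : T -> 'rV[R]_n) :
  measurable_fun setT f -> measurable_fun setT g ->
  measurable_fun setT (fun x => f x + g x).
Proof.
move=> mf mg; apply: measurable_fun_rVP => i.
rewrite (_ : _ \o _ = (fun x => f x ord0 i) \+ (fun x => g x ord0 i)); last first.
  by apply/funext => x /=; rewrite mxE.
apply: measurable_funD.
  exact: (measurableT_comp (measurable_rV_coord i) mf).
exact: (measurableT_comp (measurable_rV_coord i) mg).
Qed.

Lemma measurable_fun_rVN d (T : measurableType d) n (f : T -> 'rV[R]_n) :
  measurable_fun setT f -> measurable_fun setT (fun x => - f x).
Proof.
move=> mf; apply: measurable_fun_rVP => i.
rewrite (_ : _ \o _ = \- (fun x => f x ord0 i)); last first.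
  by apply/funext => x /=; rewrite mxE.
apply: measurable_funN.
exact: (measurableT_comp (measurable_rV_coord i) mf).
Qed.

Lemma measurable_fun_rVZ d (T : measurableType d) n (f : T -> R) (v : 'rV[R]_n) :
  measurable_fun setT f -> measurable_fun setT (fun x => f x *: v).
Proof.
move=> mf; apply: measurable_fun_rVP => i.
rewrite (_ : _ \o _ = f \* cst (v ord0 i)); last first.
  by apply/funext => x /=; rewrite mxE.
exact: measurable_funM.
Qed.

Lemma measurable_dot n (q : 'rV[R]_n) (c : R) :
  measurable_fun setT (fun x : 'rV[R]_n => dot q x + c).
Proof.
apply: (@eq_measurable_fun _ _ _ _ _
    (fun x : 'rV[R]_n => \sum_i (q ord0 i * x ord0 i) + c)).
  by move=> x _; rewrite dotE.
apply: measurable_funD => //.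
apply: measurable_sum => i; apply: measurable_funM => //.
exact: measurable_rV_coord.
Qed.

Lemma measurable_preimageT d d' (T : measurableType d) (T' : measurableType d')
    (f : T -> T') (A : set T') :
  measurable_fun setT f -> measurable A -> measurable [set x | A (f x)].
Proof. by move=> mf mA; rewrite -[X in measurable X]setTI; exact: mf. Qed.

(* Both sides compute the measure of {(x, y) | x + S y \in A /\ y \in B}: slicing
   at y gives the left-hand side, slicing at x and translating the right-hand
   one. *)
Lemma lebesgue_rV_involution n (S : 'rV[R]_n -> 'rV[R]_n) (A B : set 'rV[R]_n) :
  measurable_fun setT S -> {morph S : x y / x + y} -> involutive S ->
  measurable A -> measurable B ->
  (leb A * leb B = leb [set x | A (S x)] * leb [set x | B (- S x)%R])%E.
Proof.
move=> mS SD SK mA mB.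
have S0 : S 0 = 0 by apply: (addrI (S 0)); rewrite -SD !addr0.
have SN x : S (- S x) = - x.
  by apply: (addrI (S (S x))); rewrite -SD subrr S0 SK subrr.
pose E1 := [set z : 'rV[R]_n * 'rV[R]_n | A (z.1 + S z.2) /\ B z.2].
(* [E2] is [E1] with the slice at [x] translated by [- S x]. Its slice at [y] is empty unless
   [A (S y)], and is otherwise a translate of [[set x | B (- S x)]]. *)
pose E2 := [set z : 'rV[R]_n * 'rV[R]_n | A (S z.2) /\ B (z.2 - S z.1)].
have mE1 : measurable E1.
  apply: measurableI; apply: measurable_preimageT => //.
  apply: measurable_fun_rVD => //; exact: measurableT_comp.
have mE2 : measurable E2.
  apply: measurableI; apply: measurable_preimageT => //.
    exact: measurableT_comp.
  apply: measurable_fun_rVD => //.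
  by apply: measurable_fun_rVN; exact: measurableT_comp.
have mAS : measurable [set x | A (S x)] by exact: measurable_preimageT.
have mBS : measurable [set x | B (- S x)].
  by apply: measurable_preimageT => //; exact: measurable_fun_rVN.
have := @measure_sections _ _ _ _ R (@lebesgue_rV R n) (@lebesgue_rV R n) E1 mE1.
have := @measure_sections _ _ _ _ R (@lebesgue_rV R n) (@lebesgue_rV R n) E2 mE2.
have -> : (\int[leb]_x leb [set y | E1 (x, y)] = \int[leb]_x leb [set y | E2 (x, y)])%E.
  apply: eq_integral => x _.
  rewrite -(@lebesgue_rV_translation n (- S x) [set y | E1 (x, y)]); last first.
    by have := measurable_xsection x mE1; rewrite xsectionE.
  congr leb; apply/seteqP; rewrite /E1 /E2.
  by split => y /=; rewrite SD SN addrCA subrr addr0.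
move=> -> H; symmetry; move: H.
have intc (X : set 'rV[R]_n) (k : \bar R) (F : 'rV[R]_n -> \bar R) : measurable X ->
    (0 <= k)%E ->
    (forall y, X y -> F y = k) -> (forall y, ~ X y -> F y = 0%E) ->
    (\int[leb]_y F y = leb X * k)%E.
  move=> mX k0 FX FnX.
  rewrite (eq_integral (fun y => (\1_X y)%:E * k)%E); last first.
    move=> y _; rewrite indicE; case: (boolP (y \in X)) => yX /=.
      by rewrite mul1e FX //; exact: set_mem.
    by rewrite mul0e FnX//; apply: contraNnot yX => /mem_set.
  rewrite ge0_integralZr//; last first.
    by apply/measurable_EFinP; exact: measurable_indic.
  by rewrite integral_indic// setIT.
rewrite (@intc _ (leb [set x | B (- S x)]) _ mAS); first last.
- move=> y nAy; rewrite (_ : [set x | _] = set0) ?measure0//.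
  by apply/seteqP; split => x // -[].
- move=> y Ay; rewrite -(lebesgue_rV_translation (- S y) mBS).
  by congr leb; apply/seteqP; split=> x; rewrite /E2/= SD SN opprD opprK addrC;
    [case|].
- exact: measure_ge0.
move=> ->; rewrite muleC; apply/esym; rewrite (@intc _ (leb A) _ mB) //.
- by move=> y By; rewrite -[RHS](lebesgue_rV_translation (S y) mA);
    congr leb; apply/seteqP; split=> x; rewrite /E1 /=; [case|].
- move=> y nAy; rewrite (_ : [set x | _] = set0) ?measure0//.
  by apply/seteqP; split => x // -[].
Qed.
End translation.

(** * Null hyperplanes, boxes, and bounds on the measure *)

Section measure.
Variable R : realType.

(** Slide the hyperplane [H] along a transverse vector [e]. In the set of pairs (x, t) with x + t e
    in [H], each slice at x is one point and each slice at t is a translate of [H]. *)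
Lemma lebesgue_rV_hyperplane n (q : 'rV[R]_n) (c : R) : q != 0 ->
  leb [set x | dot q x + c = 0] = 0.
Proof.
move=> q0; set H := [set x | _].
pose e := (dot q q)^-1 *: q.
have qe : dot q e = 1 by rewrite dotZr mulVf// gt_eqF// dot_gt0.
have m0 : measurable ([set 0] : set (measurableTypeR R)) by [].
have mH : measurable H by exact: (measurable_preimageT (measurable_dot q c) m0).
pose E := [set z : 'rV[R]_n * measurableTypeR R | H (z.1 + (z.2 : R) *: e)].
have mE : measurable E.
  apply: measurable_preimageT => //.
  apply: measurable_fun_rVD => //.
  exact: measurable_fun_rVZ.
have := @measure_sections _ _ _ _ R (@lebesgue_rV R n) (@lebesgue_measure R) E mE.
rewrite (_ : (\int[_]_x _ = 0)%E); last first.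
  rewrite integral0_eq// => x _.
  have -> : [set t | E (x, t)] = [set - (dot q x + c)].
    by rewrite /E /H; apply/seteqP; split => t /=; rewrite dotDr dotZr qe; lra.
  exact: lebesgue_measure_set1.
rewrite (eq_integral (fun=> leb H)); last first.
  by move=> t _; rewrite -[RHS](lebesgue_rV_translation (t *: e) mH).
(* The line has infinite length, so [leb H] times that length can be 0 only if [leb H] is 0. *)
have loo := @lebesgue_measure_itv R `]-oo, +oo[.
rewrite set_itvNyy/= in loo.
rewrite integral_cst//= loo => /esym/eqP.
by rewrite mule_eq0 orbF => /eqP.
Qed.

(** For [r > 0] this is a ball of the sup norm, the norm of row vectors, so translated boxes are
    basic neighbourhoods with an explicit measure. *)
Definition box n (r : R) := [set x : 'rV[R]_n | forall i, `|x ord0 i| < r].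
Arguments box : clear implicits.

Lemma measurable_box n r : measurable (box n r).
Proof.
have -> : box n r = \bigcap_(i : 'I_n) [set x | `|x ord0 i| < r].
  by apply/seteqP; split => x /= H i; [move=> _; exact: H|exact: H].
apply: fin_bigcap_measurable => // i _.
have mb : measurable ([set x | `|x| < r] : set (measurableTypeR R)).
  rewrite (_ : [set x | _] = `]-r, r[%classic) //.
  by apply/seteqP; split => x /=; rewrite in_itv/= ltr_norml.
exact: (measurable_preimageT (measurable_rV_coord i) mb).
Qed.

Lemma lebesgue_rV_box n r : 0 < r -> leb (box n r) = ((r *+ 2) ^+ n)%:E.
Proof.
move=> r0; elim: n => [|n IH].
  by rewrite /= diracE mem_set ?expr0 // => -[].
rewrite /= /pushforward.
have -> : @cons_rV R n @^-1` box n.+1 r =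
    (`]-r, r[%classic : set (measurableTypeR R)) `*` box n r.
  apply/seteqP; split => -[x v] /=.
    move=> H; split.
      rewrite in_itv/= -ltr_norml.
      have := H (lshift n (ord0 : 'I_1)).
      by rewrite [X in `|X|](@row_mxEl _ 1 1 n) mxE eqxx mulr1n.
    by move=> i; have := H (rshift 1 i); rewrite [X in `|X|](@row_mxEr _ 1 1 n).
  move=> -[]; rewrite in_itv/= -ltr_norml => xr vr i.
  have [j ij|j ij] := split_ordP (i : 'I_(1 + n)); rewrite ij.
    by rewrite [X in `|X|](@row_mxEl _ 1 1 n) (ord1 j) mxE eqxx mulr1n.
  by rewrite [X in `|X|](@row_mxEr _ 1 1 n).
rewrite (@product_measure1E _ _ _ _ _ _ (@lebesgue_rV R n)) //; last first.
  exact: measurable_box.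
rewrite [X in (_ * X)%E]IH [X in (X * _)%E]lebesgue_measure_itv /= lte_fin.
by rewrite gt0_cp// -EFinB -EFinM exprS opprK mulr2n.
Qed.

Lemma lebesgue_rV_gt0 n (A : set 'rV[R]_n) (x : 'rV[R]_n) :
  measurable A -> nbhs x A -> (0 < leb A)%E.
Proof.
move=> mA /nbhs_ballP[r /= r0 rA].
have mAx : measurable [set y | A (y + x)].
  have mx : measurable_fun setT (fun y : 'rV[R]_n => y + x) by exact: measurable_fun_rVD.
  exact: (measurable_preimageT mx mA).
rewrite -(lebesgue_rV_translation x mA).
apply: (@lt_le_trans _ _ (leb (box n r))).
  by rewrite lebesgue_rV_box// lte_fin exprn_gt0// mulr2n addr_gt0.
apply: le_measure; rewrite ?inE//.
- exact: measurable_box.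
- move=> y yr /=; apply: rA; split => // i j.
  rewrite (ord1 i) /ball /= mxE opprD addrA addrAC subrr add0r normrN.
  exact: yr.
Qed.

Lemma lebesgue_rV_ltoo n (A : set 'rV[R]_n) r : 0 < r ->
  measurable A -> A `<=` box n r -> (leb A < +oo)%E.
Proof.
move=> r0 mA Ar; apply: (@le_lt_trans _ _ (leb (box n r))).
  by apply: le_measure; rewrite ?inE//; exact: measurable_box.
by rewrite lebesgue_rV_box// ltry.
Qed.
End measure.

(** * Barycentric coordinates *)

(** The matrix of a simplex has [#|K|] rows and [1 + d] columns, numbers that are equal only by a
    hypothesis; case analysis on it leaves square matrices. *)
Lemma mulmx1C_dim (R : comUnitRingType) m n (A : 'M[R]_(m, n)) (B : 'M[R]_(n, m)) :
  m = n -> A *m B = 1%:M -> B *m A = 1%:M.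
Proof. by move=> mn; case: _ / mn in A B *; exact: mulmx1C. Qed.

Section simplex.
Variables (R : realType) (d n : nat) (a : 'I_n -> 'rV[R]_d) (K : {set 'I_n}).
Variables (g : 'I_n -> 'rV[R]_d) (c : 'I_n -> R).
Hypothesis cardK : #|K| = d.+1.
Hypothesis gcK : forall i j, i \in K -> j \in K ->
  dot (g i) (a j) + c i = (i == j)%:R.
Implicit Types (i j k : 'I_n) (x y : 'rV[R]_d).

Definition bary_coord i x := dot (g i) x + c i.

(** With a column of ones put before the vertices, [gcK] says that the vertex matrix times the
    coefficient matrix is the identity. So is the product in the other order, and applying it to the
    row (1, x) gives both equations. *)
Lemma bary_decomp x :
  \sum_(i in K) bary_coord i x = 1 /\ \sum_(i in K) bary_coord i x *: a i = x.
Proof.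
pose v (i : 'I_#|K|) := enum_val i.
have vK (i : 'I_#|K|) : v i \in K by exact: enum_valP.
pose A := \matrix_(i < #|K|) a (v i).
pose G := \matrix_(i < #|K|) g (v i).
pose C : 'rV_#|K| := \row_i c (v i).
have AG : row_mx (const_mx 1 : 'cV[R]_#|K|) A *m col_mx C G^T = 1%:M.
  rewrite mul_row_col; apply/matrixP => i j; rewrite !mxE big_ord1 !mxE mul1r.
  have := gcK (vK j) (vK i); rewrite (inj_eq enum_val_inj) eq_sym => <-.
  by rewrite addrC dotE; congr (_ + _); apply: eq_bigr => k _; rewrite !mxE mulrC.
have /(_ cardK)/(congr1 (mulmx (row_mx 1%:M x))) := mulmx1C_dim _ AG.
rewrite mulmx1 mulmxA mul_row_col mul1mx mul_mx_row.
have -> : C + x *m G^T = \row_i bary_coord (v i) x.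
  apply/rowP => i; rewrite !mxE /bary_coord addrC dotE; congr (_ + _).
  by apply: eq_bigr => k _; rewrite !mxE mulrC.
move=> /eq_row_mx[/matrixP/(_ ord0 ord0) H1 H2].
split.
  rewrite big_enum_val; move: H1; rewrite !mxE eqxx mulr1n => <-.
  by apply: eq_bigr => i _; rewrite !mxE mulr1.
rewrite big_enum_val -[RHS]H2; apply/rowP => k; rewrite summxE !mxE.
by apply: eq_bigr => i _; rewrite !mxE.
Qed.

Lemma bary_conv_hullP x : conv_hull a K x <-> forall i, i \in K -> 0 <= bary_coord i x.
Proof.
have [s1 sx] := bary_decomp x; split.
  move=> [w [w0 w1 ->]] i iK; rewrite /bary_coord affine_sum//.
  by apply: sumr_ge0 => j jK; rewrite gcK// mulr_ge0.
(* [conv_hull] asks for nonnegative weights at every index, while the coordinates are controlled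
   only on [K]. *)
move=> H; exists (fun i => if i \in K then bary_coord i x else 0); split.
- by move=> i; case: ifPn => // /H.
- by rewrite -[RHS]s1; apply: eq_bigr => i ->.
- by rewrite -[LHS]sx; apply: eq_bigr => i ->.
Qed.

Lemma conv_hullE : conv_hull a K = [set x | forall i, i \in K -> 0 <= bary_coord i x].
Proof. by apply/funext => x; apply/propext; exact: bary_conv_hullP. Qed.

Lemma bary_le1 i x : conv_hull a K x -> i \in K -> bary_coord i x <= 1.
Proof.
move=> /bary_conv_hullP H iK; have [<- _] := bary_decomp x.
rewrite (bigD1 i)//= lerDl; apply: sumr_ge0 => j /andP[jK _]; exact: H.
Qed.

Lemma measurable_bary i : measurable_fun setT (bary_coord i).
Proof. exact: measurable_dot. Qed.

Lemma measurable_simplex : measurable (conv_hull a K).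
Proof.
have -> : conv_hull a K = \bigcap_(i in [set` K]) [set x | bary_coord i x \in `[0, +oo[].
  rewrite conv_hullE; apply/seteqP; split => x /= H i iK;
    by have := H i iK; rewrite /= in_itv/= andbT.
apply: fin_bigcap_measurable => // i _.
have m : measurable (`[0, +oo[%classic : set (measurableTypeR R)) by [].
exact: (measurable_preimageT (measurable_bary i) m).
Qed.

Lemma simplex_bounded : exists2 r : R, 0 < r & conv_hull a K `<=` @box R d r.
Proof.
exists (1 + \sum_i \sum_k `|a i ord0 k|).
  by rewrite ltr_pwDl// sumr_ge0// => i _; rewrite sumr_ge0.
move=> x xK k; have [_ <-] := bary_decomp x.
rewrite summxE ltr_pwDl// (le_trans (ler_norm_sum _ _ _))//.
rewrite big_mkcond/=; apply: ler_sum => i _; case: ifPn => iK; last first.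
  exact: sumr_ge0.
rewrite (bigD1 k)//= ler_wpDr ?sumr_ge0// mxE normrM ler_piMl//.
have xK' := xK; move/bary_conv_hullP : xK => /(_ _ iK) b0.
by rewrite ger0_norm// bary_le1.
Qed.

Lemma leb_simplex_ltoo : (leb (conv_hull a K) < +oo)%E.
Proof.
have [r r0 H] := simplex_bounded.
exact: lebesgue_rV_ltoo r0 measurable_simplex H.
Qed.

Lemma continuous_affine (q : 'rV[R]_d) (e : R) : continuous (fun x => dot q x + e).
Proof.
have cq : continuous (dot q).
  rewrite (_ : dot q = fun x : 'rV[R]_d => \sum_i q ord0 i * x ord0 i); last first.
    by apply/funext => y; rewrite dotE.
  apply: (@continuous_big R _ +%R 0 xpredT (@add_continuous R)) => i _ x.
  exact: (@cvgMr R _ (nbhs x) _ _ _ _ (@coord_continuous R 1 d ord0 i x)).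
by move=> x; exact: (cvgD (cq x) (cvg_cst e)).
Qed.

Lemma nbhs_simplex x :
  (forall i, i \in K -> 0 < bary_coord i x) -> nbhs x (conv_hull a K).
Proof.
move=> H; rewrite conv_hullE.
have H1 (i : 'I_n) : nbhs x [set y | i \in K -> 0 <= bary_coord i y].
  have [iK|_] := boolP (i \in K); last by apply: (filterS _ filterT).
  have H2 : nbhs x [set y | 0 < bary_coord i y].
    refine (cvgr_gt _ (@continuous_affine (g i) (c i) x) _ (H i iK)).
  by refine (filterS _ H2) => y /= /ltW.
by refine (filterS _ (filter_forall _ H1)) => y Hy i; exact: Hy.
Qed.
End simplex.

(** * Volume of a simplex and integrals of its barycentric coordinates *)

Section simplex_integral.
Variables (R : realType) (d ni nb : nat).
Local Notation n := (ni + nb)%N.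
Variables (a : 'I_n -> 'rV[R]_d) (K : {set 'I_n}).
Variables (g : 'I_n -> 'rV[R]_d) (c : 'I_n -> R).
Hypothesis cardK : #|K| = d.+1.
Hypothesis gcK : forall i j, i \in K -> j \in K ->
  dot (g i) (a j) + c i = (i == j)%:R.
Implicit Types (i j k : 'I_n) (x y : 'rV[R]_d).
Local Notation bary := (bary_coord g c).

Lemma bary_barycentre i : i \in K ->
  bary i (d.+1%:R^-1 *: \sum_(j in K) a j) = d.+1%:R^-1.
Proof.
move=> iK; rewrite scaler_sumr /bary_coord affine_sum; last first.
  by rewrite sumr_const cardK -[LHS]mulr_natr mulVf// pnatr_eq0.
rewrite (bigD1 i)//= gcK// eqxx mulr1 big1 ?addr0// => j /andP[jK ji].
by rewrite gcK// eq_sym (negPf ji) mulr0.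
Qed.

Lemma leb_simplex_gt0 : (0 < leb (conv_hull a K))%E.
Proof.
apply: (@lebesgue_rV_gt0 _ _ _ (d.+1%:R^-1 *: \sum_(j in K) a j)).
  exact: measurable_simplex cardK gcK.
by apply: (nbhs_simplex cardK gcK) => i iK; rewrite bary_barycentre.
Qed.

Lemma vol_gt0 : 0 < vol a K.
Proof.
by rewrite fine_gt0// leb_simplex_gt0 (leb_simplex_ltoo cardK gcK).
Qed.

Lemma volE : (vol a K)%:E = leb (conv_hull a K).
Proof. by rewrite fineK// ge0_fin_numE// (leb_simplex_ltoo cardK gcK). Qed.

(** As [d > 0], there is a second vertex; coordinate [i] is 0 there and 1 at [a i], so it is not
    constant. *)
Lemma gradient_neq0 i : (0 < d)%N -> i \in K -> g i != 0.
Proof.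
move=> d0 iK.
have [j jK ji] : exists2 j, j \in K & j != i.
  have : (0 < #|K :\ i|)%N by move: (cardsD1 i K); rewrite iK cardK add1n => -[<-].
  by move=> /card_gt0P[j]; rewrite in_setD1 => /andP[ji jK]; exists j.
apply/eqP => g0; have := gcK iK iK; have := gcK iK jK.
rewrite g0 !(dotC 0) !dot0r !add0r eqxx eq_sym (negPf ji) => -> /esym/eqP.
by rewrite oner_eq0.
Qed.

Lemma ae_simplex_interior : (0 < d)%N ->
  {ae leb, forall x, conv_hull a K x -> forall i, i \in K -> 0 < bary i x}.
Proof.
move=> d0.
have H i : {ae (@lebesgue_rV R d), forall x, i \in K -> bary i x != 0}.
  have [iK|_] := boolP (i \in K); last exact: aeW.
  exists [set x | bary i x = 0]; split.
  - have m0 : measurable ([set 0] : set (measurableTypeR R)) by [].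
    exact: (measurable_preimageT (measurable_dot (g i) (c i)) m0).
  - exact: lebesgue_rV_hyperplane (gradient_neq0 d0 iK).
  - by move=> x /= /not_implyP[_ /negP]; rewrite negbK => /eqP.
refine (filterS _ (filter_forall _ H)) => x Hx /(bary_conv_hullP cardK gcK) H0 i iK.
by rewrite lt_neqAle eq_sym Hx//= H0.
Qed.

Lemma integrable_bary i : i \in K ->
  leb.-integrable (conv_hull a K) (EFin \o bary i).
Proof.
move=> iK; apply: measurable_bounded_integrable.
- exact: measurable_simplex cardK gcK.
- exact: leb_simplex_ltoo cardK gcK.
- by apply: measurable_funTS; exact: measurable_bary.
- exists 1; split => // M M1 x xK; apply: le_trans (ltW M1).
  rewrite ger0_norm; first exact: (bary_le1 cardK gcK).
  by move/(bary_conv_hullP cardK gcK) : xK; exact.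
Qed.

Section swap.
Variables i j : 'I_n.
Hypotheses (iK : i \in K) (jK : j \in K) (ij : i != j).

(* S is the affine involution that exchanges the vertices [a i] and [a j] of K,
   and S0 is its linear part. *)
Let S0 x := x + dot (g j - g i) x *: (a i - a j).
Let t0 := (c j - c i) *: (a i - a j).
Let S x := S0 x + t0.

Let dot_vertices k : k \in K -> dot (g k) (a i - a j) = (k == i)%:R - (k == j)%:R.
Proof. by move=> kK; rewrite -!(gcK kK)// dotBr opprD addrACA subrr addr0. Qed.

Let S0K : involutive S0.
Proof.
move=> x; have S0N : dot (g j - g i) (S0 x) = - dot (g j - g i) x.
  rewrite /S0 dotDr dotZr [X in _ * X]dotBl !dot_vertices// !eqxx (negPf ij).
  by rewrite (eq_sym j) (negPf ij) /=; ring.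
by rewrite {1}/S0 S0N scaleNr /S0 addrK.
Qed.

Let S0D : {morph S0 : x y / x + y}.
Proof. by move=> x y; rewrite /S0 dotDr scalerDl addrACA. Qed.

(** [S x] is [x] plus (bary j x - bary i x) times (a i - a j): coordinate [i] gains what coordinate
    [j] loses, and the others do not move. *)
Let bary_swap k x : k \in K -> bary k (S x) =
  if k == i then bary j x else if k == j then bary i x else bary k x.
Proof.
move=> kK; rewrite /bary_coord /S /t0 /S0 -addrA -scalerDl dotDr dotZr.
rewrite dot_vertices// dotBl.
case: (eqVneq k i) => [->|ki]; first by rewrite (negPf ij) /= mulr0n; ring.
case: (eqVneq k j) => [->|kj] /=; first by rewrite mulr0n; ring.
by rewrite mulr0n; ring.
Qed.

Let measurable_S0 : measurable_fun setT S0.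
Proof.
apply: measurable_fun_rVD => //; apply: measurable_fun_rVZ.
have := measurable_dot (g j - g i) 0; congr measurable_fun.
by apply/funext => x; rewrite addr0.
Qed.

Let measurable_S : measurable_fun setT S.
Proof. exact: measurable_fun_rVD. Qed.

Let preimage_swap : [set x | conv_hull a K (S x)] = conv_hull a K.
Proof.
rewrite (conv_hullE cardK gcK); apply/seteqP; split => x /= H k kK.
  case: (eqVneq k i) => [ki|ki].
    by have := H j jK; rewrite bary_swap// eq_sym (negPf ij) eqxx ki.
  case: (eqVneq k j) => [kj|kj].
    by have := H i iK; rewrite bary_swap// eqxx kj.
  by have := H k kK; rewrite bary_swap// (negPf ki) (negPf kj).
by rewrite bary_swap//; case: ifP => _; [|case: ifP => _]; exact: H.
Qed.

(** In [inv] the factor [leb [set x | conv_hull a K (- S0 x)]] does not depend on [B]. The choice of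
    [K] for [B] shows that it equals [leb (conv_hull a K)], which then cancels. *)
Let swap_measure A : measurable A -> leb [set x | A (S x)] = leb A.
Proof.
move=> mA.
have mK := measurable_simplex cardK gcK.
have inv (B : set 'rV[R]_d) : measurable B ->
    (leb B * leb (conv_hull a K) =
     leb [set x | B (S x)] * leb [set x | conv_hull a K (- S0 x)%R])%E.
  move=> mB; rewrite -(lebesgue_rV_translation t0 mB).
  rewrite [LHS](lebesgue_rV_involution measurable_S0 S0D S0K)//.
  have mt : measurable_fun setT (fun y : 'rV[R]_d => y + t0) by exact: measurable_fun_rVD.
  exact: (measurable_preimageT mt mB).
have lK : forall x y : \bar R,
    (x * leb (conv_hull a K) = y * leb (conv_hull a K))%E -> x = y.
  move=> x y; rewrite -volE => /(congr1 (fun z => z * ((vol a K)^-1)%:E)%E).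
  by rewrite -!muleA -EFinM mulfV ?mule1// gt_eqF// vol_gt0.
have kK : leb [set x | conv_hull a K (- S0 x)] = leb (conv_hull a K).
  by apply/lK; rewrite [RHS]inv// preimage_swap muleC.
by apply/lK; rewrite [RHS]inv// kK.
Qed.

Lemma integral_bary_swap :
  (\int[leb]_(x in conv_hull a K) (bary i x)%:E =
   \int[leb]_(x in conv_hull a K) (bary j x)%:E)%E.
Proof.
have mK := measurable_simplex cardK gcK.
pose f : {mfun 'rV[R]_d >-> 'rV[R]_d} :=
  HB.pack S (isMeasurableFun.Build _ _ _ _ _ measurable_S).
transitivity (\int[pushforward leb f]_(x in conv_hull a K) (bary i x)%:E)%E.
  by apply: eq_measure_integral => A mA _; rewrite -[LHS]swap_measure.
rewrite (@ge0_integral_pushforward _ _ _ _ _ _ measurable_S (@lebesgue_rV R d))//=.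
- rewrite [X in integral _ X _]preimage_swap; apply: eq_integral => x _ /=.
  by rewrite bary_swap// eqxx.
- by apply/measurable_EFinP; apply: measurable_funTS; exact: measurable_bary.
- by move=> x /set_mem/(bary_conv_hullP cardK gcK) H; rewrite lee_fin H.
Qed.
End swap.

Lemma integral_bary i : i \in K ->
  \int[leb]_(x in conv_hull a K) bary i x = vol a K / d.+1%:R.
Proof.
move=> iK.
have mK := measurable_simplex cardK gcK.
have : (\sum_(j in K) \int[leb]_(x in conv_hull a K) (bary j x)%:E = (vol a K)%:E)%E.
  (* Off [K] the coefficients are arbitrary, so the coordinates are replaced by 0 there to have a
     sum of nonnegative functions over all indices. *)
  pose F j x := (if j \in K then bary j x else 0)%:E.
  transitivity (\sum_j \int[leb]_(x in conv_hull a K) F j x)%E.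
    rewrite [LHS]big_mkcond; apply: eq_bigr => j _; rewrite /F.
    by case: ifPn => // _; rewrite integral0.
  rewrite -ge0_integral_sum//; first last.
  - move=> j x /(bary_conv_hullP cardK gcK) H; rewrite /F lee_fin.
    by case: ifPn => // /H.
  - move=> j; apply/measurable_EFinP; rewrite /F; case: (j \in K) => //.
    by apply: measurable_funTS; exact: measurable_bary.
  rewrite (eq_integral (cst 1%:E)); last first.
    by move=> x _; rewrite sumEFin -big_mkcond (bary_decomp cardK gcK x).1.
  by rewrite integral_cst// mul1e volE.
rewrite (eq_bigr (fun=> \int[leb]_(x in conv_hull a K) (bary i x)%:E)%E); last first.
  by move=> j jK; case: (eqVneq j i) => [->//|ji]; exact: integral_bary_swap.
rewrite -(fineK (integrable_fin_num _ (integrable_bary iK)))//.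
rewrite sumEFin sumr_const cardK => -[<-].
by rewrite -[X in X / _]mulr_natr mulfK// pnatr_eq0.
Qed.
End simplex_integral.

(** * Quadratic forms and the largest eigenvalue *)

Section form.
Variables (R : realType) (d : nat).
Implicit Types (A B : 'M[R]_d) (p q v w : 'rV[R]_d).

Lemma formE A p q : form A p q = dot (p *m A) q.
Proof. by []. Qed.

Lemma formDl A p q v : form A (p + q) v = form A p v + form A q v.
Proof. by rewrite /form !mulmxDl mxE. Qed.

Lemma formDr A p q v : form A v (p + q) = form A v p + form A v q.
Proof. exact: dotDr. Qed.

Lemma formZl A k p q : form A (k *: p) q = k * form A p q.
Proof. by rewrite /form -!scalemxAl mxE. Qed.

Lemma formZr A k p q : form A p (k *: q) = k * form A p q.
Proof. exact: dotZr. Qed.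

Lemma form0r A p : form A p 0 = 0.
Proof. exact: dot0r. Qed.

Lemma formC A p q : A^T = A -> form A p q = form A q p.
Proof.
move=> As; have -> : form A q p = (p *m A *m q^T)^T ord0 ord0.
  by rewrite !trmx_mul trmxK As mulmxA.
by rewrite [RHS]mxE.
Qed.

Lemma form_sumE A p q :
  form A p q = \sum_l \sum_k p ord0 k * q ord0 l * A k l.
Proof.
rewrite formE dotE; apply: eq_bigr => l _; rewrite mxE mulr_suml.
by apply: eq_bigr => k _; rewrite mulrAC.
Qed.

Lemma form_CauchySchwarz A p q : A^T = A -> (forall v, 0 <= form A v v) ->
  form A p q ^+ 2 <= form A p p * form A q q.
Proof.
move=> As A0.
have H s t : 0 <= s ^+ 2 * form A p p + 2 * s * t * form A p q + t ^+ 2 * form A q q.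
  have := A0 (s *: p + t *: q).
  rewrite !(formDl, formDr, formZl, formZr) (formC q p As); congr (0 <= _); ring.
(* This choice gives ga (al ga - be^2) >= 0, enough when ga > 0. The next one serves ga = 0, where
   it reads - be^2 (al + 2) >= 0 and forces be = 0. *)
have := H (form A q q) (- form A p q).
have := H (- form A p q) (form A p p + 1).
have := A0 p; have := A0 q.
set al := form A p p; set be := form A p q; set ga := form A q q => ga0 al0.
have [ga_gt0 _|ga_le0] := ltP 0 ga.
  have -> : ga ^+ 2 * al + 2 * ga * - be * be + (- be) ^+ 2 * ga =
      ga * (al * ga - be ^+ 2).
    by ring.
  by rewrite pmulr_rge0// subr_ge0.
have -> : ga = 0 by apply/eqP; rewrite eq_le ga0 ga_le0.
by rewrite !mulr0 !addr0 => + _; have := sqr_ge0 be; nra.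
Qed.

Lemma continuous_form A : continuous (fun v => form A v v).
Proof.
rewrite (_ : (fun v : 'rV[R]_d => form A v v) =
    (fun v : 'rV[R]_d => \sum_l (dot (row l A^T) v + 0) * v ord0 l)); last first.
  apply/funext => v; rewrite formE dotE; apply: eq_bigr => l _; congr (_ * _).
  by rewrite addr0 mxE dotE; apply: eq_bigr => k _; rewrite !mxE mulrC.
apply: (@continuous_big R _ +%R 0 xpredT (@add_continuous R)) => l _ v.
exact: (@cvgM R _ (nbhs v) _ _ _ _ _ (@continuous_affine _ _ _ _ v)
  (@coord_continuous R 1 d ord0 l v)).
Qed.

Lemma form1 v w : form 1%:M v w = dot v w.
Proof. by rewrite formE mulmx1. Qed.

Lemma continuous_sqr_norm : continuous (fun v : 'rV[R]_d => dot v v).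
Proof.
by under eq_fun do rewrite -form1; exact: continuous_form.
Qed.

Lemma compact_sphere : compact [set v : 'rV[R]_d | dot v v = 1].
Proof.
apply: bounded_closed_compact.
  exists 1; split => // M M1 v /= v1; apply: le_trans (ltW M1).
  rewrite [`|v|]mx_normrE; apply: bigmax_le => // -[i k] _ /=.
  rewrite (ord1 i) -(@expr_le1 _ 2)// real_normK ?num_real// -v1 dotE (bigD1 k)//=.
  by rewrite expr2 lerDl sumr_ge0// => l _; rewrite -expr2 sqr_ge0.
have : closed [set (1 : R)] by exact: closed_eq.
by move/continuous_closedP : continuous_sqr_norm; apply.
Qed.

(* The largest Rayleigh quotient M is attained at some u on the unit sphere;
   M%:M - A is then positive semidefinite and vanishes at u, so that u is an
   eigenvector. *)
Lemma form_le_lambda_max A v : A^T = A -> form A v v <= lambda_max A * dot v v.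
Proof.
move=> As.
have [->|v0] := eqVneq v 0; first by rewrite form0r dot0r mulr0.
have normalize (w : 'rV[R]_d) : w != 0 -> exists2 k, k != 0 & dot (k *: w) (k *: w) = 1.
  move=> w0; exists (Num.sqrt (dot w w))^-1.
    by rewrite invr_eq0 gt_eqF// sqrtr_gt0 dot_gt0.
  rewrite dotZl dotZr mulrA -invfM -expr2 sqr_sqrtr ?dot_ge0//.
  by rewrite mulVf// gt_eqF// dot_gt0.
have [u uS uM] : exists2 u, dot u u = 1 &
    forall w, dot w w = 1 -> form A w w <= form A u u.
  have [k k0 k1] := normalize _ v0.
  have := @EVT_max_rV R d (fun w => form A w w) [set v | dot v v = 1] _ compact_sphere.
  case; first by exists (k *: v).
    by apply: continuous_subspaceT; exact: continuous_form.
  move=> u uS H; exists u; first exact: set_mem uS.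
  by move=> w w1; apply: H; rewrite inE.
set M := form A u u in uM.
have MA w : form A w w <= M * dot w w.
  have [->|w0] := eqVneq w 0; first by rewrite form0r dot0r mulr0.
  have [k k0 k1] := normalize _ w0.
  have := uM _ k1; rewrite formZl formZr mulrA -expr2 => H.
  rewrite -(@ler_pM2l _ (k ^+ 2)) ?exprn_even_gt0// (le_trans H)//.
  by rewrite mulrCA expr2 -mulrA -dotZr -dotZl k1 mulr1.
have eigM : eigenvalue A M.
  apply/eigenvalueP; exists u; last first.
    by apply/eqP => u0; move: uS; rewrite u0 dot0r => /esym/eqP; rewrite oner_eq0.
  have BE p q : form (M%:M - A) p q = M * dot p q - form A p q.
    by rewrite formE mulmxBr mul_mx_scalar dotBl dotZl.
  have Bs : (M%:M - A)^T = M%:M - A by rewrite linearB/= tr_scalar_mx As.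
  have B0 w : 0 <= form (M%:M - A) w w by rewrite BE subr_ge0.
  suff : u *m (M%:M - A) = 0.
    by rewrite mulmxBr mul_mx_scalar => /eqP; rewrite subr_eq0 => /eqP.
  (* Cauchy-Schwarz for the semidefinite form [M%:M - A]: since it vanishes at [u], it pairs [u] to
     0 with every [w]. *)
  apply: dot_eq0 => w; rewrite -formE; apply/eqP; rewrite -sqrf_eq0 eq_le sqr_ge0 andbT.
  have := form_CauchySchwarz u w Bs B0.
  by rewrite [form _ u u]BE uS mulr1 subrr mul0r.
(* The supremum is meaningful only for a bounded set; each eigenvalue is a Rayleigh quotient, hence
   at most [M]. *)
have lub : lambda_max A >= M.
  apply: ub_le_sup => //; exists M => l /eigenvalueP[w wA w0].
  have := MA w; rewrite formE wA dotZl ler_pM2r//; exact: dot_gt0.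
by rewrite (le_trans (MA v))// ler_wpM2r// dot_ge0.
Qed.
End form.

(** * Altitudes and gradients *)

Lemma derive_affine (R : realType) d (q : 'rV[R]_d) (c : R) (x v : 'rV[R]_d) :
  'D_v (fun y => dot q y + c) x = dot q v.
Proof.
rewrite /derive; apply: cvg_lim => //.
apply: (cvg_trans (G := cst (dot q v) @ (0 : R)^')); last exact: cvg_cst.
apply: near_eq_cvg; near=> h.
have h0 : h != 0 by near: h; exact: nbhs_dnbhs_neq.
by rewrite /= dotDr dotZr -(addrA (h * _)) addrK [RHS]mulKf.
Unshelve. all: by end_near. Qed.

Section geometry.
Variables (R : realType) (d ni nb : nat).
Local Notation n := (ni + nb)%N.
Variables (a : 'I_n -> 'rV[R]_d) (K : {set 'I_n}).
Variables (g : 'I_n -> 'rV[R]_d) (c : 'I_n -> R).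
Hypothesis d_gt0 : (0 < d)%N.
Hypothesis cardK : #|K| = d.+1.
Hypothesis gcK : forall i j, i \in K -> j \in K ->
  dot (g i) (a j) + c i = (i == j)%:R.
Implicit Types (i j k : 'I_n) (x y p q : 'rV[R]_d).
Local Notation bary := (bary_coord g c).

Lemma dot_vertexB i j k : i \in K -> j \in K -> k \in K ->
  dot (g i) (a j - a k) = (i == j)%:R - (i == k)%:R.
Proof.
by move=> iK jK kK; rewrite dotBr -!gcK// opprD addrACA subrr addr0.
Qed.

Lemma gradient_sum x : \sum_(i in K) dot (g i) x = 0.
Proof.
have [s1 _] := bary_decomp cardK gcK x; have [s0 _] := bary_decomp cardK gcK 0.
transitivity (\sum_(i in K) bary i x - \sum_(i in K) bary i 0); last first.
  by rewrite s1 s0 subrr.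
rewrite -sumrB.
by apply: eq_bigr => i _; rewrite /bary_coord dot0r add0r addrK.
Qed.

Lemma gradient_decomp x : \sum_(i in K) dot (g i) x *: a i = x.
Proof.
have [_ s1] := bary_decomp cardK gcK x; have [_ s0] := bary_decomp cardK gcK 0.
transitivity (\sum_(i in K) bary i x *: a i - \sum_(i in K) bary i 0 *: a i).
  rewrite -sumrB; apply: eq_bigr => i _.
  by rewrite /bary_coord dot0r add0r -scalerBl addrK.
by rewrite s1 s0 subr0.
Qed.

Lemma dot_decomp q x : dot q x = \sum_(i in K) dot (g i) x * dot q (a i).
Proof.
rewrite -{1}(gradient_decomp x) dot_sumr.
by apply: eq_bigr => i _; rewrite dotZr.
Qed.

(** This will show that a basis function belonging to a vertex outside [K] has zero affine piece on
    [K]. *)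
Lemma affine_eq0 q e : (forall i, i \in K -> dot q (a i) + e = 0) -> q = 0 /\ e = 0.
Proof.
move=> H; have q0 : q = 0.
  apply: dot_eq0 => x; rewrite dot_decomp.
  rewrite (eq_bigr (fun i => dot (g i) x * - e)).
    by rewrite -mulr_suml gradient_sum mul0r.
  by move=> i /H/eqP; rewrite addr_eq0 => /eqP ->.
split=> //; have /card_gt0P[i iK] : (0 < #|K|)%N by rewrite cardK.
by have := H i iK; rewrite q0 dotC dot0r add0r.
Qed.

Lemma euclid_norm_gt0 q : q != 0 -> 0 < euclid_norm q.
Proof. by move=> q0; rewrite sqrtr_gt0 dot_gt0. Qed.

Lemma sqr_euclid_norm q : euclid_norm q ^+ 2 = dot q q.
Proof. by rewrite sqr_sqrtr// dot_ge0. Qed.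

Lemma euclid_normZ (t : R) q : 0 <= t -> euclid_norm (t *: q) = t * euclid_norm q.
Proof.
move=> t0; rewrite /euclid_norm dotZl dotZr mulrA -expr2 sqrtrM ?sqr_ge0//.
by rewrite sqrtr_sqr ger0_norm.
Qed.

Lemma dot_le_euclid_norm p q : dot p q <= euclid_norm p * euclid_norm q.
Proof.
have H : dot p q ^+ 2 <= (euclid_norm p * euclid_norm q) ^+ 2.
  rewrite exprMn !sqr_euclid_norm -!form1 form_CauchySchwarz ?trmx1// => v.
  by rewrite form1; exact: dot_ge0.
apply: le_trans (ler_norm _) _.
rewrite -(@ler_pXn2r _ 2)// ?nnegrE ?mulr_ge0 ?sqrtr_ge0//.
by rewrite real_normK ?num_real.
Qed.

(** [unit_normal] is picked by choice, so uniqueness has to be proved: any candidate is a positive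
    multiple of [g i], and its norm fixes the multiple. *)
Lemma unit_normalE i : i \in K -> unit_normal a K i = (euclid_norm (g i))^-1 *: g i.
Proof.
move=> iK.
have gi0 := euclid_norm_gt0 (gradient_neq0 cardK gcK d_gt0 iK).
have ex : is_unit_normal a K i ((euclid_norm (g i))^-1 *: g i).
  split.
  - by rewrite euclid_normZ ?invr_ge0 ?sqrtr_ge0// mulVf// gt_eqF.
  - move=> j l; rewrite !in_setD1 => /andP[ji jK] /andP[li lK].
    by rewrite dotZl dot_vertexB// !(eq_sym i) (negPf ji) (negPf li) subrr mulr0.
  - move=> j; rewrite !in_setD1 => /andP[ji jK].
    by rewrite dotZl dot_vertexB// eqxx eq_sym (negPf ji) subr0 mulr1 invr_gt0.
have : is_unit_normal a K i (unit_normal a K i).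
  exact: (@getPex _ [set m | is_unit_normal a K i m] (ex_intro _ _ ex)).
move: (unit_normal a K i) => m [m1 morth mpos].
have [j] : exists j, j \in K :\ i.
  apply/card_gt0P; move: (cardsD1 i K); rewrite iK cardK add1n => -[<-]//.
move=> jKi; have /mpos := jKi; set p := dot _ _ => p0.
(* [m] takes the same value at all vertices other than [a i], and the gradients sum to 0, so only
   the term of [a i] survives. *)
have mE : m = p *: g i.
  apply/eqP; rewrite -subr_eq0; apply/eqP/dot_eq0 => x.
  rewrite dotBl dotZl dot_decomp; apply/eqP; rewrite subr_eq0; apply/eqP.
  transitivity (\sum_(k in K) dot (g k) x * (dot m (a k) - dot m (a j))).
    under [RHS]eq_bigr do rewrite mulrBr.
    by rewrite sumrB -mulr_suml gradient_sum mul0r subr0.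
  rewrite (bigD1 i)//= -dotBr -/p big1 ?addr0 1?mulrC// => k /andP[kK ki].
  by rewrite -dotBr morth ?mulr0// in_setD1 ki.
have gne : euclid_norm (g i) != 0 by rewrite gt_eqF.
rewrite mE; congr (_ *: _); apply: (mulIf gne).
by rewrite mulVf// -euclid_normZ ?ltW// -mE.
Qed.

(** Coordinate [i] drops by 1 from [a i] to the opposite hyperplane, so Cauchy-Schwarz bounds the
    distance below. The foot of the perpendicular, [a i] minus [g i] divided by its squared norm,
    attains the bound. *)
Lemma heightE i : i \in K -> height a K i = (euclid_norm (g i))^-1.
Proof.
move=> iK.
have g0 := gradient_neq0 cardK gcK d_gt0 iK.
have gi0 := euclid_norm_gt0 g0.
set S := [set euclid_norm (a i - y) | y in aff_hull a (K :\ i)].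
have lbS : lbound S (euclid_norm (g i))^-1.
  move=> _ [y [w w1 yE] <-].
  rewrite -(@ler_pM2l _ _ gi0) mulfV ?gt_eqF//.
  apply: le_trans (dot_le_euclid_norm _ _); rewrite dotBr.
  have : dot (g i) (a i) + c i = 1 by rewrite gcK// eqxx.
  have : dot (g i) y + c i = 0.
    rewrite yE affine_sum// big1// => j; rewrite in_setD1 => /andP[ji jK].
    by rewrite gcK// eq_sym (negPf ji) mulr0.
  lra.
have memS : S (euclid_norm (g i))^-1.
  pose y := a i - (dot (g i) (g i))^-1 *: g i.
  exists y; last first.
    rewrite /y opprB addrCA subrr addr0 euclid_normZ ?invr_ge0 ?dot_ge0//.
    by rewrite -sqr_euclid_norm expr2 invfM -mulrA mulVf ?mulr1// gt_eqF.
  have yi : bary i y = 0.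
    rewrite /bary_coord /y dotBr dotZr mulVf ?gt_eqF ?dot_gt0//.
    by rewrite addrAC gcK// eqxx subrr.
  have [s1 sy] := bary_decomp cardK gcK y.
  exists (bary ^~ y).
    by rewrite -s1 [RHS](big_setD1 i)//= yi add0r.
  by rewrite -{1}sy (big_setD1 i)//= yi scale0r add0r.
apply/eqP; rewrite eq_le; apply/andP; split.
  by apply: ge_inf => //; exists (euclid_norm (g i))^-1.
by apply: lb_le_inf => //; exists (euclid_norm (g i))^-1.
Qed.

Lemma qvecE i : i \in K -> qvec a K i = g i.
Proof.
move=> iK; rewrite /qvec heightE// unit_normalE// invrK scalerA mulfV ?scale1r//.
by rewrite gt_eqF// euclid_norm_gt0// (gradient_neq0 cardK gcK).
Qed.

(** [f] is known only on [K], but [K] is a neighbourhood of the barycentre, whose coordinates are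
    all 1 / (d + 1). *)
Lemma grad_onE (f : 'rV[R]_d -> R) q e :
  (forall x, conv_hull a K x -> f x = dot q x + e) -> grad_on a K f = q.
Proof.
move=> fE; apply/rowP => k; rewrite mxE.
rewrite (@near_eq_derive _ _ _ _ (fun x => dot q x + e)).
  rewrite derive_affine dotE (bigD1 k)//= mxE !eqxx mulr1 big1 ?addr0// => l lk.
  by rewrite mxE (negPf lk) mulr0.
have := @nbhs_simplex R d n a K g c cardK gcK (d.+1%:R^-1 *: \sum_(i in K) a i).
move=> H; refine (filterS _ (H _)); first exact: fE.
by move=> i iK; rewrite (bary_barycentre cardK gcK).
Qed.

End geometry.

(** * Integrals of almost everywhere signed functions *)

Section Rintegral.
Context d (T : measurableType d) (R : realType).
Variables (mu : {measure set T -> \bar R}) (D : set T).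
Hypothesis mD : measurable D.
Implicit Types f g : T -> R.

Lemma ae_eq_Rintegral f g :
  mu.-integrable D (EFin \o f) -> mu.-integrable D (EFin \o g) ->
  {ae mu, forall x, D x -> f x = g x} ->
  \int[mu]_(x in D) f x = \int[mu]_(x in D) g x.
Proof.
move=> /integrableP[mf _] /integrableP[mg _] fg; congr fine.
apply: ae_eq_integral => //.
by refine (filterS _ fg) => x H Dx; rewrite /= H.
Qed.

(** Both claims are proved together because additivity at each step needs the partial sum to be
    integrable. *)
Lemma Rintegral_sum (I : finType) (P : pred I) (F : I -> T -> R) :
  (forall i, P i -> mu.-integrable D (EFin \o F i)) ->
  mu.-integrable D (EFin \o (fun x => \sum_(i | P i) F i x)) /\
  \int[mu]_(x in D) (\sum_(i | P i) F i x) = \sum_(i | P i) \int[mu]_(x in D) F i x.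
Proof.
move=> iF; elim: (index_enum I) => [|i s [IH1 IH2]].
  have -> : (fun x => \sum_(i <- [::] | P i) F i x) = cst 0.
    by apply/funext => x; rewrite big_nil.
  by rewrite big_nil Rintegral_cst// mul0r; split=> //; exact: integrable0.
rewrite big_cons; have [Pi|nPi] := ifPn.
  have -> : (fun x => \sum_(j <- i :: s | P j) F j x) =
      (fun x => F i x + \sum_(j <- s | P j) F j x).
    by apply/funext => x; rewrite big_cons Pi.
  split; last by rewrite RintegralD ?iF// IH2.
  have := integrableD mD (iF i Pi) IH1; congr (mu.-integrable D).
have -> // : (fun x => \sum_(j <- i :: s | P j) F j x) =
    (fun x => \sum_(j <- s | P j) F j x).
by apply/funext => x; rewrite big_cons (negPf nPi).
Qed.

Lemma ae_Rintegral_ge0 f : mu.-integrable D (EFin \o f) ->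
  {ae mu, forall x, D x -> 0 <= f x} -> 0 <= \int[mu]_(x in D) f x.
Proof.
move=> fi f0; rewrite (@ae_eq_Rintegral f (Num.norm \o f))//.
- by apply: Rintegral_ge0 => x _ /=.
- exact: integrable_norm.
- by refine (filterS _ f0) => x H Dx; rewrite /= ger0_norm// H.
Qed.

Lemma ae_Rintegral_le0 f : mu.-integrable D (EFin \o f) ->
  {ae mu, forall x, D x -> f x <= 0} -> \int[mu]_(x in D) f x <= 0.
Proof.
move=> fi f0; rewrite -oppr_ge0 -mulN1r -RintegralZl//.
apply: ae_Rintegral_ge0.
  have := integrableZl mD (-1) fi; congr (mu.-integrable D).
  by refine (filterS _ f0) => x H Dx; rewrite mulN1r oppr_ge0 H.
Qed.

(** If the integral were 0, then [f] would vanish almost everywhere on [D]; being positive there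
    almost everywhere, it would leave [D] null. *)
Lemma ae_Rintegral_gt0 f : (0 < mu D)%E -> mu.-integrable D (EFin \o f) ->
  {ae mu, forall x, D x -> 0 < f x} -> 0 < \int[mu]_(x in D) f x.
Proof.
move=> D0 fi f0; rewrite lt_neqAle ae_Rintegral_ge0// ?andbT; last first.
  by refine (filterS _ f0) => x H Dx; rewrite ltW// H.
apply/eqP => /esym.
rewrite (@ae_eq_Rintegral f (Num.norm \o f))//; last 2 first.
- exact: integrable_norm.
- by refine (filterS _ f0) => x H Dx; rewrite /= gtr0_norm// H.
move=> int0; have : (\int[mu]_(x in D) `|(EFin \o f) x| = 0)%E.
  rewrite -[RHS]/(0%:E) -int0 /Rintegral fineK//.
  exact: integrable_fin_num (integrable_norm fi).
case/integrableP : (fi) => mf _.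
move=> /(ae_eq_integral_abs _ mD mf) f00.
have [A [mA A0 DA]] : {ae mu, forall x, ~ D x}.
  refine (filterS2 _ _ f0 f00) => x H1 H2 Dx.
  by have [fx0] := H2 Dx; have := H1 Dx; rewrite fx0 ltxx.
have : (mu D <= mu A)%E.
  by apply: le_measure; rewrite ?inE// => x Dx; apply: DA => /=; apply.
by rewrite A0 leNgt D0.
Qed.
End Rintegral.

(** * The averaged diffusion matrix *)

Section mean_mx.
Variables (R : realType) (d ni nb : nat).
Local Notation n := (ni + nb)%N.
Variables (a : 'I_n -> 'rV[R]_d) (K : {set 'I_n}).
Variable D : 'rV[R]_d -> 'M[R]_d.
Hypothesis mK : measurable (conv_hull a K).
Hypothesis lebK_gt0 : (0 < leb (conv_hull a K))%E.
Hypothesis lebK_ltoo : (leb (conv_hull a K) < +oo)%E.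
Hypothesis D_int : forall k l,
  leb.-integrable (conv_hull a K) (EFin \o (fun x => D x k l)).

Lemma mean_mx_sym : {ae leb, forall x, conv_hull a K x -> (D x)^T = D x} ->
  (mean_mx a D K)^T = mean_mx a D K.
Proof.
move=> Ds; apply/matrixP => k l; rewrite !mxE; congr (_ * _).
apply: ae_eq_Rintegral => //.
by refine (filterS _ Ds) => x H xK; rewrite -{1}H// mxE.
Qed.

Lemma mean_mx_pos : {ae leb, forall x, conv_hull a K x -> pos_def (D x)} ->
  pos_def (mean_mx a D K).
Proof.
move=> Dp v v0.
have i1 k l : leb.-integrable (conv_hull a K)
    (EFin \o (fun x => v ord0 k * v ord0 l * D x k l)).
  have := integrableZl mK (v ord0 k * v ord0 l) (D_int k l).
  by congr (integrable _ _).
have i2 l := @Rintegral_sum _ _ R leb _ mK _ xpredT _ (fun k _ => i1 k l).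
have [i3 e3] := @Rintegral_sum _ _ R leb _ mK _ xpredT _ (fun l _ => (i2 l).1).
have -> : form (mean_mx a D K) v v =
    (vol a K)^-1 * \int[leb]_(x in conv_hull a K) form (D x) v v.
  rewrite form_sumE.
  under [in RHS]eq_Rintegral do rewrite form_sumE.
  rewrite e3 big_distrr; apply: eq_bigr => l _.
  rewrite (i2 l).2 big_distrr; apply: eq_bigr => k _.
  by rewrite RintegralZl// !mxE mulrCA.
apply: mulr_gt0; first by rewrite invr_gt0 fine_gt0// lebK_gt0.
apply: ae_Rintegral_gt0 => //.
  move: i3; congr (integrable _ _); apply/funext => x /=.
  by rewrite form_sumE.
by refine (filterS _ Dp) => x H xK; exact: H.
Qed.
End mean_mx.

(** * Element contributions *)

Section angle.
Variables (R : realType) (d : nat).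

(** [acos] is inverted by [cos] only on [-1, 1]; Cauchy-Schwarz puts the quotient there, and the
    cosine of an angle up to [pi / 2] is nonnegative. *)
Lemma form_le0_acos (A : 'M[R]_d) (p q : 'rV[R]_d) :
  A^T = A -> pos_def A -> p != 0 -> q != 0 ->
  0 < acos (- (form A p q / (form_norm A p * form_norm A q))) <= pi / 2 ->
  form A p q <= 0.
Proof.
move=> As Ap p0 q0.
have A0 v : 0 <= form A v v.
  by have [->|/Ap/ltW//] := eqVneq v 0; rewrite form0r.
have np : 0 < form_norm A p by rewrite sqrtr_gt0 Ap.
have nq : 0 < form_norm A q by rewrite sqrtr_gt0 Ap.
set y := form A p q / _ => /andP[a0 api].
have y1 : `|y| <= 1.
  rewrite normrM normfV (gtr0_norm (mulr_gt0 np nq)) ler_pdivrMr ?mulr_gt0// mul1r.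
  rewrite -(@ler_pXn2r _ 2)// ?nnegrE ?mulr_ge0 ?(ltW np) ?(ltW nq)//.
  rewrite real_normK ?num_real// exprMn !sqr_sqrtr//.
  exact: form_CauchySchwarz.
have : 0 <= cos (acos (- y)).
  by rewrite cos_ge0_pihalf// api andbT (le_trans _ (ltW a0))// oppr_le0 divr_ge0 ?pi_ge0.
rewrite acosK ?oppr_ge0; last by rewrite in_itv/= -ler_norml normrN.
by rewrite pmulr_lle0// invr_gt0 mulr_gt0.
Qed.
End angle.

Section element.
Variables (R : realType) (d ni nb : nat).
Local Notation n := (ni + nb)%N.
Variables (a : 'I_n -> 'rV[R]_d) (K : {set 'I_n}).
Variables (g : 'I_n -> 'rV[R]_d) (c : 'I_n -> R) (phi : 'I_n -> 'rV[R]_d -> R).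
Hypothesis d_gt0 : (0 < d)%N.
Hypothesis cardK : #|K| = d.+1.
Hypothesis gcK : forall i j, i \in K -> j \in K ->
  dot (g i) (a j) + c i = (i == j)%:R.
Hypothesis gcN : forall i, i \notin K -> g i = 0 /\ c i = 0.
Hypothesis phiE : forall i x, conv_hull a K x -> phi i x = bary_coord g c i x.
Implicit Types (i j k : 'I_n) (x y p q : 'rV[R]_d).

Lemma baryN i x : i \notin K -> bary_coord g c i x = 0.
Proof. by move=> /gcN[gi ci]; rewrite /bary_coord gi ci dotC dot0r addr0. Qed.

Lemma phi_ge0 i x : conv_hull a K x -> 0 <= phi i x.
Proof.
move=> xK; rewrite phiE//; have [iK|iK] := boolP (i \in K); last by rewrite baryN.
by move/(bary_conv_hullP cardK gcK) : xK; exact.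
Qed.

Lemma phi_sum x : conv_hull a K x -> \sum_i phi i x = 1.
Proof.
move=> xK; have [<- _] := bary_decomp cardK gcK x.
rewrite [RHS]big_mkcond; apply: eq_bigr => i _; rewrite phiE//.
by case: ifPn => // iK; rewrite baryN.
Qed.

Lemma phi_le1 i x : conv_hull a K x -> phi i x <= 1.
Proof.
move=> xK; rewrite -(phi_sum xK) (bigD1 i)//= lerDl sumr_ge0// => j _.
exact: phi_ge0.
Qed.

Lemma measurable_phi i : measurable_fun (conv_hull a K) (phi i).
Proof.
apply: (@eq_measurable_fun _ _ _ _ _ (bary_coord g c i)).
  by move=> x /set_mem xK; rewrite phiE.
by apply: measurable_funTS; exact: measurable_bary.
Qed.

Lemma integrable_phiM i j :
  leb.-integrable (conv_hull a K) (EFin \o (fun x => phi i x * phi j x)).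
Proof.
apply: measurable_bounded_integrable.
- exact: measurable_simplex cardK gcK.
- exact: leb_simplex_ltoo cardK gcK.
- by apply: measurable_funM; exact: measurable_phi.
- exists 1; split => // M M1 x xK; apply: le_trans (ltW M1).
  rewrite ger0_norm ?mulr_ge0 ?phi_ge0//.
  by rewrite mulr_ile1 ?phi_ge0 ?phi_le1.
Qed.

Lemma integral_phi i :
  \int[leb]_(x in conv_hull a K) phi i x = (i \in K)%:R * (vol a K / d.+1%:R).
Proof.
have [iK|iK] := boolP (i \in K).
  rewrite mul1r -(integral_bary cardK gcK iK); apply: eq_Rintegral => x /set_mem xK.
  exact: phiE.
rewrite mul0r (@eq_Rintegral _ _ _ _ _ (cst 0)).
  by rewrite Rintegral_cst ?mul0r//; exact: measurable_simplex cardK gcK.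
by move=> x /set_mem xK; rewrite phiE// baryN.
Qed.

(** Row sums of the mass matrix collapse because the basis functions sum to 1 on [K]; this is the
    contribution of [K] to the lumped mass. *)
Lemma integral_phiM_sum i :
  \sum_j \int[leb]_(x in conv_hull a K) (phi j x * phi i x) =
  (i \in K)%:R * (vol a K / d.+1%:R).
Proof.
have mK := measurable_simplex cardK gcK.
have [_ <-] := @Rintegral_sum _ _ R leb _ mK _ xpredT _
  (fun j _ => integrable_phiM j i).
rewrite -integral_phi.
apply: eq_Rintegral => x /set_mem xK.
by rewrite -mulr_suml phi_sum// mul1r.
Qed.

Lemma grad_on_phi i : grad_on a K (phi i) = g i.
Proof. by apply: (grad_onE cardK gcK) => x xK; rewrite phiE. Qed.

Lemma grad_on_phi_sum : \sum_i grad_on a K (phi i) = 0.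
Proof.
apply: dot_eq0 => x; rewrite dotC dot_sumr -[RHS](gradient_sum cardK gcK x).
rewrite [RHS]big_mkcond; apply: eq_bigr => i _; rewrite grad_on_phi.
by case: ifPn => [_|/gcN[-> _]]; rewrite ?dot0r// dotC.
Qed.

Variable D : 'rV[R]_d -> 'M[R]_d.
Hypothesis D_int : forall (k l : 'I_d),
  leb.-integrable (conv_hull a K) (EFin \o (fun x => D x k l)).
Variable Omega : set 'rV[R]_d.
Hypothesis K_int : (conv_hull a K)° `<=` Omega.
Hypothesis D_sym : forall x, Omega x -> (D x)^T = D x.
Hypothesis D_pos : forall x, Omega x -> pos_def (D x).

Lemma ae_simplex_Omega :
  {ae leb, forall x, conv_hull a K x -> Omega x}.
Proof.
refine (filterS _ (ae_simplex_interior cardK gcK d_gt0)) => x H xK.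
by apply: K_int; apply: (nbhs_simplex cardK gcK); exact: H.
Qed.

Let DK := mean_mx a D K.

Lemma mean_mx_simplex_sym : DK^T = DK.
Proof.
apply: mean_mx_sym => //; first exact: measurable_simplex cardK gcK.
by refine (filterS _ ae_simplex_Omega) => x H xK; exact/D_sym/H.
Qed.

Lemma mean_mx_simplex_pos : pos_def DK.
Proof.
apply: mean_mx_pos => //.
- exact: measurable_simplex cardK gcK.
- exact: leb_simplex_gt0 cardK gcK.
- exact: leb_simplex_ltoo cardK gcK.
- by refine (filterS _ ae_simplex_Omega) => x H xK; exact/D_pos/H.
Qed.

Lemma form_grad_le0 i j :
  (i \in K -> j \in K -> 0 < dihedral a D K i j <= pi / 2) ->
  form DK (grad_on a K (phi i)) (grad_on a K (phi j)) <= 0.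
Proof.
move=> angle; rewrite !grad_on_phi.
have [iK|/gcN[-> _]] := boolP (i \in K); last first.
  by rewrite (formC _ _ mean_mx_simplex_sym) form0r.
have [jK|/gcN[-> _]] := boolP (j \in K); last by rewrite form0r.
have gi0 := gradient_neq0 cardK gcK d_gt0 iK.
have gj0 := gradient_neq0 cardK gcK d_gt0 jK.
have := angle iK jK; rewrite /dihedral !(qvecE d_gt0 cardK gcK)//.
exact: form_le0_acos mean_mx_simplex_sym mean_mx_simplex_pos gi0 gj0.
Qed.

(** Here [s] stands for [1 - theta]. The form at [g i] is at most [lambda_max DK] times the squared
    norm of [g i], that is, [lambda_max DK] over the squared altitude. *)
Lemma form_grad_le i (s dt : R) : 0 <= s -> 0 <= dt ->
  (0 < s -> i \in K ->
   dt <= (s * d.+1%:R)^-1 * (height a K i ^+ 2 / lambda_max DK)) ->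
  s * dt * (vol a K * form DK (grad_on a K (phi i)) (grad_on a K (phi i))) <=
  (i \in K)%:R * (vol a K / d.+1%:R).
Proof.
move=> s0 dt0 dtle; rewrite grad_on_phi.
have v0 := vol_gt0 cardK gcK.
have [iK|/gcN[-> _]] := boolP (i \in K); last first.
  by rewrite form0r !mulr0 mul0r.
rewrite mul1r mulrCA ler_pM2l//.
have [->|s_neq0] := eqVneq s 0; first by rewrite !mul0r invr_ge0.
have {s_neq0}s_gt0 : 0 < s by rewrite lt_neqAle eq_sym s_neq0.
have gi0 := gradient_neq0 cardK gcK d_gt0 iK.
have gg0 := dot_gt0 gi0.
have fle := form_le_lambda_max (g i) mean_mx_simplex_sym.
have fgt0 := mean_mx_simplex_pos gi0.
(* Positivity of the eigenvalue makes its inverse in [dtle] a genuine one. *)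
have l0 : 0 < lambda_max DK by rewrite -(pmulr_lgt0 _ gg0) (lt_le_trans fgt0).
have := dtle s_gt0 iK.
rewrite (heightE d_gt0 cardK gcK)// exprVn sqr_euclid_norm -!invfM -div1r.
rewrite ler_pdivlMr ?mulr_gt0// => H.
rewrite -div1r ler_pdivlMr//; apply: le_trans H.
apply: (@le_trans _ _ (s * dt * (lambda_max DK * dot (g i) (g i)) * d.+1%:R)).
  by rewrite ler_wpM2r// ler_wpM2l// mulr_ge0.
by rewrite le_eqVlt; apply/orP; left; apply/eqP; ring.
Qed.
End element.

(** * The discrete maximum principle *)

Section topology.
Variables (R : realType) (d : nat).
Implicit Types (X Omega : set 'rV[R]_d).

Lemma compact_closure_bounded Omega : bounded_set Omega -> compact (closure Omega).
Proof.
move=> [M [Mreal OM]]; apply: bounded_closed_compact; last exact: closed_closure.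
exists M; split => // r Mr x xO.
have cS : closed [set y : 'rV[R]_d | `|y| <= r].
  have := @closed_closed_ball_ R 'rV[R]_d 0 r; congr closed; apply/funext => y.
  by rewrite /closed_ball_ /= sub0r normrN.
suff : closure [set y : 'rV[R]_d | `|y| <= r] x by rewrite -(closure_id _).1.
by apply: closureS xO => y /(OM _ Mr).
Qed.

(** A point of the closure that maximizes one coordinate cannot be interior: moving by [r / 2] along
    that axis would stay in [Omega] and increase the coordinate. *)
Lemma boundary_nonempty Omega : (0 < d)%N -> Omega !=set0 -> bounded_set Omega ->
  boundary Omega !=set0.
Proof.
move=> d0 [x0 Ox0] bO; pose k := Ordinal d0.
have [x /set_mem xO xmax] := @EVT_max_rV R d (fun x => x ord0 k) (closure Omega)
  (ex_intro _ x0 (subset_closure Ox0)) (compact_closure_bounded bO)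
  (continuous_subspaceT (@coord_continuous R 1 d ord0 k)).
exists x; split => // /nbhs_ballP[r /= r0 rO].
have : Omega (x + (r / 2) *: delta_mx ord0 k).
  apply: rO; split => // i j; rewrite /ball/= (ord1 i) !mxE opprD addNKr normrN.
  rewrite eqxx/= normrM gtr0_norm ?divr_gt0//.
  by case: (j == k); rewrite ?normr1 ?normr0 ?mulr1 ?mulr0// ltr_pdivrMr// ltr_pMr// ltr1n.
move=> /subset_closure/mem_set/xmax; rewrite !mxE !eqxx mulr1 gerDl.
by rewrite leNgt divr_gt0.
Qed.

Lemma compact_boundary Omega : bounded_set Omega -> compact (boundary Omega).
Proof.
move=> bO; apply: subclosed_compact (compact_closure_bounded bO) _.
  by apply: closedI; [exact: closed_closure|apply: open_closedC; exact: open_interior].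
by move=> x [].
Qed.

Lemma ex_is_max (U : nat -> 'rV[R]_d -> R) (P : pred nat) (X : set 'rV[R]_d) N n0 :
  P n0 -> (forall n, P n -> (n <= N)%N) -> X !=set0 -> compact X ->
  (forall n, {within X, continuous (U n)}) ->
  exists M, is_max [set U n x | n in [set n | P n] & x in X] M.
Proof.
move=> Pn0 PN X0 cX cU.
have H n : exists x, X x /\ forall y, X y -> U n y <= U n x.
  have [x xX xmax] := EVT_max_rV X0 cX (cU n).
  by exists x; split; [exact: set_mem|move=> y Xy; apply: xmax; exact: mem_set].
have [x Hx] := choice H.
have n0N : (n0 < N.+1)%N by rewrite ltnS PN.
pose i0 := Ordinal n0N.
case: (@Order.TotalTheory.arg_maxP _ _ _ i0 (fun i : 'I_N.+1 => P i)
  (fun i => U i (x i)) Pn0) => i Pi imax.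
exists (U i (x i)); split; first by exists i => //; exists (x i) => //; exact: (Hx i).1.
move=> _ [m /= Pm [y Xy <-]].
have mN : (m < N.+1)%N by rewrite ltnS PN.
exact: le_trans ((Hx m).2 _ Xy) (imax (Ordinal mN) Pm).
Qed.
End topology.

Section maximum_principle.
Variables (R : realFieldType) (ni nb : nat).
Local Notation n := (ni + nb)%N.

(* At an interior node where w is maximal the row sums make the stiffness term
   nonnegative, while the right-hand side is a nonnegative combination of the
   values of v with total weight m i. *)
Lemma theta_step_le (m : 'I_ni -> R) (A : 'I_ni -> 'I_n -> R) (r s C : R)
    (v w : 'I_n -> R) :
  0 <= r -> 0 <= s ->
  (forall i, 0 < m i) ->
  (forall i, \sum_j A i j = 0) ->
  (forall i j, j != lshift nb i -> A i j <= 0) ->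
  (forall i, s * A i (lshift nb i) <= m i) ->
  (forall i, m i * w (lshift nb i) + r * \sum_j A i j * w j <=
             m i * v (lshift nb i) - s * \sum_j A i j * v j) ->
  (forall j, v j <= C) -> (forall j, w (rshift ni j) <= C) ->
  forall j, w j <= C.
Proof.
move=> r0 s0 m0 A0 Aoff Adiag step vC wC j0.
case: (@Order.TotalTheory.arg_maxP _ _ _ j0 xpredT w isT) => k _ kmax.
apply: le_trans (kmax j0 isT) _.
case: (split_ordP k) => [i ki|j ->]; last exact: wC.
have wk : 0 <= \sum_j A i j * w j.
  have -> : \sum_j A i j * w j = \sum_j A i j * (w j - w k).
    by under [RHS]eq_bigr do rewrite mulrBr; rewrite sumrB -mulr_suml A0 mul0r subr0.
  apply: sumr_ge0 => j _; have [->|jk] := eqVneq j k.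
    by rewrite subrr mulr0.
  rewrite mulr_le0 ?Aoff -?ki//; rewrite subr_le0; exact: kmax.
have rhs : m i * v (lshift nb i) - s * \sum_j A i j * v j <= m i * C.
  rewrite -subr_ge0.
  have -> : m i * C - (m i * v (lshift nb i) - s * \sum_j A i j * v j) =
     m i * (C - v (lshift nb i)) - s * \sum_j A i j * (C - v j).
    under [in RHS]eq_bigr do rewrite mulrBr.
    by rewrite sumrB -mulr_suml A0; ring.
  (* The diagonal term joins the mass term: the node itself gets the weight [m i] minus [s] times
     the diagonal entry, nonnegative by [Adiag], and the other weights are nonnegative by [Aoff]. *)
  rewrite (bigD1 (lshift nb i))//= (mulrDr s) opprD addrA mulrA -mulrBl.
  rewrite addr_ge0// ?mulr_ge0 ?subr_ge0//.
  rewrite oppr_ge0 mulr_ge0_le0// sumr_le0// => j ji.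
  by rewrite mulr_le0_ge0 ?Aoff ?subr_ge0.
rewrite -(ler_pM2l (m0 i)) ki (le_trans _ rhs)// (le_trans _ (step i))//.
by rewrite lerDl mulr_ge0.
Qed.
End maximum_principle.

(** * Finite element functions on the mesh *)

Section triangulation.
Variables (R : realType) (d ni nb : nat).
Local Notation n := (ni + nb)%N.
Variables (Omega : set 'rV[R]_d) (a : 'I_n -> 'rV[R]_d) (T : {set {set 'I_n}}).
Variable phi : 'I_n -> 'rV[R]_d -> R.
Hypothesis T_tri : triangulation Omega a T.
Hypothesis phi_basis : nodal_basis Omega a T phi.

Lemma vertex_conv_hull (K : {set 'I_n}) i : i \in K -> conv_hull a K (a i).
Proof.
move=> iK; exists (fun j => (j == i)%:R); split => //.
  by rewrite (bigD1 i)//= eqxx big1 ?addr0// => j /andP[_ /negPf ->].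
rewrite (bigD1 i)//= eqxx scale1r big1 ?addr0// => j /andP[_ /negPf ->].
by rewrite scale0r.
Qed.

Lemma nodal_basis_affine K : K \in T -> exists g c,
  [/\ forall i j, i \in K -> j \in K -> dot (g i) (a j) + c i = (i == j)%:R,
      forall i, i \notin K -> g i = 0 /\ c i = 0 &
      forall i x, conv_hull a K x -> phi i x = bary_coord g c i x].
Proof.
move=> KT.
have H j : exists gc : 'rV[R]_d * R,
    forall x, conv_hull a K x -> phi j x = dot gc.1 x + gc.2.
  by have [_ /(_ K KT)[g [c H]] _] := phi_basis j; exists (g, c).
have [gc Hgc] := choice H.
have gcE i j : j \in K -> dot (gc i).1 (a j) + (gc i).2 = (i == j)%:R.
  move=> jK; rewrite -Hgc; first by have [_ _ ->] := phi_basis i; rewrite eq_sym.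
  exact: vertex_conv_hull.
exists (fun i => (gc i).1), (fun i => (gc i).2); split.
- by move=> i j iK jK; exact: gcE.
- move=> i iK.
  apply: (affine_eq0 (tri_card T_tri KT) (fun i j _ => @gcE i j)) => j jK.
  by rewrite gcE//; case: eqVneq iK => // ->; rewrite jK.
- by move=> i x xK; rewrite /bary_coord Hgc.
Qed.

Lemma vertex_closure j : closure Omega (a j).
Proof.
have [K KT jK] := tri_vertices T_tri j.
by rewrite (tri_cover T_tri); exists K => //; exact: vertex_conv_hull.
Qed.

Lemma fe_fun_vertex (u : 'cV[R]_n) j : fe_fun phi u (a j) = u j ord0.
Proof.
rewrite /fe_fun (bigD1 j)//= big1 ?addr0.
  by have [_ _ ->] := phi_basis j; rewrite eqxx mulr1.
by move=> k kj; have [_ _ ->] := phi_basis k; rewrite eq_sym (negPf kj) mulr0.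
Qed.

Lemma fe_fun_le (u : 'cV[R]_n) C x : (forall j, u j ord0 <= C) ->
  closure Omega x -> fe_fun phi u x <= C.
Proof.
move=> uC; rewrite (tri_cover T_tri) => -[K KT xK].
have [g [c [gcK gcN phiE]]] := nodal_basis_affine KT.
have cardK := tri_card T_tri KT.
rewrite -[C]mul1r -(phi_sum cardK gcK gcN phiE xK) mulr_suml.
apply: ler_sum => j _; rewrite mulrC ler_wpM2l//.
exact: (phi_ge0 cardK gcK gcN phiE).
Qed.

Lemma continuous_fe_fun (u : 'cV[R]_n) X : X `<=` closure Omega ->
  {within X, continuous (fe_fun phi u)}.
Proof.
move=> XO; apply: (continuous_subspaceW XO).
apply: (@continuous_big R _ +%R 0 xpredT (@add_continuous R)) => j _ x.
have [cj _ _] := phi_basis j.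
apply: cvgMr; exact: cj.
Qed.
End triangulation.

Section rows.
Variables (R : realType) (d ni nb : nat).
Local Notation n := (ni + nb)%N.
Variables (a : 'I_n -> 'rV[R]_d) (T : {set {set 'I_n}}).
Variables (phi : 'I_n -> 'rV[R]_d -> R) (D : 'rV[R]_d -> 'M[R]_d).

(** The block [e] is the identity on the left of the scheme and 0 on the right; an interior row does
    not see it, so one formula serves both sides. *)
Lemma block_row (e : 'M[R]_nb) r (i : 'I_ni) (u : 'cV[R]_n) :
  ((block_mx (lumped_mass a T phi) 0 0 e +
    r *: block_mx (stiff11 a T phi D) (stiff12 a T phi D) 0 0) *m u)
    (lshift nb i) ord0 =
  (\sum_j mass a T phi (lshift nb i) j) * u (lshift nb i) ord0 +
  r * \sum_j stiff a T phi D (lshift nb i) j * u j ord0.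
Proof.
rewrite mulmxDl -scalemxAl [LHS]mxE [X in _ + X]mxE; congr (_ + _ * _).
  rewrite mxE (bigD1 (lshift nb i))//= big1 ?addr0.
    by rewrite block_mxEul !mxE eqxx mulr1n.
  move=> j; case: (split_ordP j) => [k ->|k ->] ki.
    rewrite block_mxEul !mxE (_ : (i == k) = false) ?mul0r//.
    by apply: contraNF ki => /eqP ->.
  by rewrite block_mxEur mxE mul0r.
rewrite mxE; apply: eq_bigr => j _; congr (_ * _).
by case: (split_ordP j) => k ->; rewrite ?block_mxEul ?block_mxEur mxE.
Qed.
End rows.

Lemma theta_scheme_le (R : realType) (d : nat) (d_gt0 : (0 < d)%N)
  (Omega : set 'rV[R]_d) (Tf : R)
  (f g : 'rV[R]_d -> R -> R)
  (D : 'rV[R]_d -> 'M[R]_d)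
  (D_sym : forall x, Omega x -> (D x)^T = D x)
  (D_pos : forall x, Omega x -> pos_def (D x))
  (ni nb : nat) (a : 'I_(ni + nb) -> 'rV[R]_d)
  (T : {set {set 'I_(ni + nb)}}) (T_tri : triangulation Omega a T)
  (phi : 'I_(ni + nb) -> 'rV[R]_d -> R)
  (phi_basis : nodal_basis Omega a T phi)
  (D_int : forall K, K \in T -> forall k l,
     leb.-integrable (conv_hull a K) (EFin \o (fun x => D x k l)))
  (f_int : forall t, 0 < t <= Tf -> forall K, K \in T -> forall i : 'I_ni,
     leb.-integrable (conv_hull a K)
       (EFin \o (fun x => f x t * phi (lshift nb i) x)))
  (theta dt : R) (theta_01 : 0 < theta <= 1) (dt_gt0 : 0 < dt)
  (angles : forall K, K \in T -> forall i j, i \in K -> j \in K -> i != j ->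
     0 < dihedral a D K i j <= pi / 2)
  (dt_le : theta < 1 -> forall K, K \in T -> forall i, i \in K ->
     dt <= ((1 - theta) * d.+1%:R)^-1 *
           (height a K i ^+ 2 / lambda_max (mean_mx a D K)))
  (f_le0 : forall x t, Omega x -> 0 < t <= Tf -> f x t <= 0)
  (n : nat) (n_le : n.+1%:R * dt <= Tf) (v w : 'cV[R]_(ni + nb)) (C : R) :
  (block_mx (lumped_mass a T phi) 0 0 1%:M + (theta * dt) *:
     block_mx (stiff11 a T phi D) (stiff12 a T phi D) 0 0) *m w =
  (block_mx (lumped_mass a T phi) 0 0 0 - ((1 - theta) * dt) *:
     block_mx (stiff11 a T phi D) (stiff12 a T phi D) 0 0) *m v
    + dt *: rhs a T phi f g theta dt n ->
  (forall j, v j ord0 <= C) -> (forall j, w (rshift ni j) ord0 <= C) ->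
  forall j, w j ord0 <= C.
Proof.
move=> scheme vC wC.
have /andP[theta0 theta1] := theta_01.
pose m (i : 'I_ni) := \sum_j mass a T phi (lshift nb i) j.
have mE i : m i = \sum_(K in T) (lshift nb i \in K)%:R * (vol a K / d.+1%:R).
  rewrite /m /mass exchange_big; apply: eq_bigr => K KT /=.
  have [G [c [gcK gcN phiE]]] := nodal_basis_affine T_tri phi_basis KT.
  exact: integral_phiM_sum (tri_card T_tri KT) gcK gcN phiE _.
have vol0 K : K \in T -> 0 < vol a K.
  move=> KT; have [G [c [gcK _ _]]] := nodal_basis_affine T_tri phi_basis KT.
  exact: vol_gt0 (tri_card T_tri KT) gcK.
apply: (@theta_step_le R ni nb m (fun i => stiff a T phi D (lshift nb i))
  (theta * dt) ((1 - theta) * dt) C (fun j => v j ord0) (fun j => w j ord0)) => //.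
- by rewrite mulr_ge0 ?ltW.
- by rewrite mulr_ge0 ?subr_ge0// ltW.
- move=> i; rewrite mE.
  have [K KT iK] := tri_vertices T_tri (lshift nb i).
  rewrite (bigD1 K)//= iK mul1r ltr_pwDl ?divr_gt0 ?vol0//.
  by rewrite sumr_ge0// => L /andP[LT _]; rewrite mulr_ge0// divr_ge0// ltW// vol0.
- move=> i; rewrite /stiff exchange_big big1//= => K KT.
  have [G [c [gcK gcN phiE]]] := nodal_basis_affine T_tri phi_basis KT.
  rewrite -mulr_sumr -dot_sumr.
  by rewrite (grad_on_phi_sum (tri_card T_tri KT) gcK gcN phiE) dot0r mulr0.
- move=> i j ji; rewrite /stiff sumr_le0// => K KT.
  have [G [c [gcK gcN phiE]]] := nodal_basis_affine T_tri phi_basis KT.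
  rewrite pmulr_rle0 ?vol0//.
  apply: (form_grad_le0 d_gt0 (tri_card T_tri KT) gcK gcN phiE (D_int _ KT)
    (tri_interior T_tri KT) D_sym D_pos) => iK jK.
  by apply: angles => //; rewrite eq_sym.
- move=> i; rewrite mE /stiff mulr_sumr; apply: ler_sum => K KT.
  have [G [c [gcK gcN phiE]]] := nodal_basis_affine T_tri phi_basis KT.
  apply: (form_grad_le d_gt0 (tri_card T_tri KT) gcK gcN phiE (D_int _ KT)
    (tri_interior T_tri KT) D_sym D_pos) => [||th iK].
  + by rewrite subr_ge0.
  + exact: ltW.
  + by apply: dt_le => //; rewrite -subr_gt0.
- move=> i.
  have := congr1 (fun M : 'cV_(ni + nb) => M (lshift nb i) ord0) scheme.
  rewrite /= block_row => ->.
  (* The two sides now differ only by the load, so its nonpositivity is what remains. *)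
  rewrite mxE -scaleNr block_row mulNr gerDl mxE.
  rewrite pmulr_rle0// /rhs col_mxEu mxE /load sumr_le0// => K KT.
  (* [theta > 0] keeps the sampling time positive even at [n = 0], and [theta <= 1] keeps it at or
     before the end of the step. *)
  have t0T : 0 < n%:R * dt + theta * dt <= Tf.
    apply/andP; split; first by rewrite ltr_wpDl ?mulr_gt0// mulr_ge0// ltW.
    apply: le_trans n_le; rewrite -natr1 mulrDl lerD2l ler_pM2r//.
  have [G [c [gcK gcN phiE]]] := nodal_basis_affine T_tri phi_basis KT.
  have cardK := tri_card T_tri KT.
  apply: ae_Rintegral_le0.
  + exact: measurable_simplex cardK gcK.
  + exact: f_int.
  + have Kint := tri_interior T_tri KT.
    refine (filterS _ (ae_simplex_Omega d_gt0 cardK gcK Kint)) => x H xK.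
    rewrite mulr_le0_ge0//; first by apply: f_le0 => //; exact: H.
    exact: (phi_ge0 cardK gcK gcN phiE).
Qed.

Theorem theorem3p2 (R : realType) (d : nat) (d_gt0 : (0 < d)%N)
  (Omega : set 'rV[R]_d) (Omega_dom : polyhedral_domain Omega)
  (Tf : R) (Tf_gt0 : 0 < Tf)
  (f g : 'rV[R]_d -> R -> R) (u0 : 'rV[R]_d -> R)
  (D : 'rV[R]_d -> 'M[R]_d)
  (D_sym : forall x, Omega x -> (D x)^T = D x)
  (D_pos : forall x, Omega x -> pos_def (D x))
  (ni nb : nat) (a : 'I_(ni + nb) -> 'rV[R]_d)
  (T : {set {set 'I_(ni + nb)}}) (T_tri : triangulation Omega a T)
  (phi : 'I_(ni + nb) -> 'rV[R]_d -> R)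
  (phi_basis : nodal_basis Omega a T phi)
  (D_int : forall K, K \in T -> forall k l,
     leb.-integrable (conv_hull a K) (EFin \o (fun x => D x k l)))
  (f_int : forall t, 0 < t <= Tf -> forall K, K \in T -> forall i : 'I_ni,
     leb.-integrable (conv_hull a K)
       (EFin \o (fun x => f x t * phi (lshift nb i) x)))
  (theta dt : R) (theta_01 : 0 < theta <= 1) (dt_gt0 : 0 < dt)
  (N : nat) (N_gt0 : (0 < N)%N) (N_le : N%:R * dt <= Tf)
  (angles : forall K, K \in T -> forall i j, i \in K -> j \in K -> i != j ->
     0 < dihedral a D K i j <= pi / 2)
  (dt_le : theta < 1 -> forall K, K \in T -> forall i, i \in K ->
     dt <= ((1 - theta) * d.+1%:R)^-1 *
           (height a K i ^+ 2 / lambda_max (mean_mx a D K)))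
  (u : nat -> 'cV[R]_(ni + nb))
  (u_init : u 0%N = \col_j u0 (a j))
  (u_scheme : forall n, (n < N)%N ->
     let M11 := lumped_mass a T phi in
     let A11 := stiff11 a T phi D in
     let A12 := stiff12 a T phi D in
     (block_mx M11 0 0 1%:M + (theta * dt) *: block_mx A11 A12 0 0) *m u n.+1 =
     (block_mx M11 0 0 0 - ((1 - theta) * dt) *: block_mx A11 A12 0 0) *m u n
       + dt *: rhs a T phi f g theta dt n)
  (f_le0 : forall x t, Omega x -> 0 < t <= Tf -> f x t <= 0) :
  let U n := fe_fun phi (u n) in
  exists Mall Mbnd Mini : R,
  [/\ is_max [set U n x | n in [set n | (n <= N)%N] & x in closure Omega] Mall,
      is_max [set U n x | n in [set n | (1 <= n <= N)%N] & x in boundary Omega]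
        Mbnd,
      is_max [set U 0%N x | x in closure Omega] Mini,
      Mall <= Num.max 0 (Num.max Mbnd Mini) &
      0 <= Num.max Mbnd Mini -> Mall = Num.max 0 (Num.max Mbnd Mini)].
Proof.
move=> U.
have [_ _ O0 bO _] := Omega_dom.
have cO := compact_closure_bounded bO.
have clO0 : closure Omega !=set0 by have [x /subset_closure] := O0; exists x.
have bndO : boundary Omega `<=` closure Omega by move=> x [].
have [Mall Hall] := @ex_is_max R d U (fun n => (n <= N)%N) (closure Omega)
  N 0%N isT (fun _ => id) clO0 cO
  (fun n => @continuous_fe_fun R d ni nb Omega a T phi phi_basis (u n) _ (fun _ => id)).
have PN n : (1 <= n <= N)%N -> (n <= N)%N by case/andP.
have [Mbnd Hbnd] := @ex_is_max R d U (fun n => (1 <= n <= N)%N)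
  (boundary Omega) N 1%N N_gt0
  PN (boundary_nonempty d_gt0 O0 bO) (compact_boundary bO)
  (fun n => @continuous_fe_fun R d ni nb Omega a T phi phi_basis (u n) _ bndO).
have [x0 /set_mem x0O x0max] := EVT_max_rV clO0 cO
  (@continuous_fe_fun R d ni nb Omega a T phi phi_basis (u 0%N) _ (fun _ => id)).
exists Mall, Mbnd, (U 0%N x0).
(* The bound is carried from step to step: [Mini] covers the initial values, and [Mbnd] the boundary
   nodes of each new step. *)
have uC n : (n <= N)%N -> forall j, u n j ord0 <= Num.max Mbnd (U 0%N x0).
  elim: n => [_ j|n IH nN].
    rewrite le_max; apply/orP; right; rewrite -(fe_fun_vertex phi_basis).
    by apply: x0max; apply: mem_set; exact: (vertex_closure T_tri).
  have nT : n.+1%:R * dt <= Tf.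
    by apply: le_trans N_le; rewrite ler_pM2r// ler_nat.
  apply: (theta_scheme_le d_gt0 D_sym D_pos T_tri phi_basis D_int f_int theta_01
    dt_gt0 angles dt_le f_le0 nT (u_scheme n nN) (IH (ltnW nN))) => j.
  rewrite le_max; apply/orP; left; rewrite -(fe_fun_vertex phi_basis).
  apply: Hbnd.2; exists n.+1 => //; exists (a (rshift ni j)) => //.
  exact: (tri_boundary_vertices T_tri).
have MallC : Mall <= Num.max Mbnd (U 0%N x0).
  have [[n nN [x xO <-]] _] := Hall.
  exact: (fe_fun_le T_tri phi_basis (uC n nN) xO).
have CMall : Num.max Mbnd (U 0%N x0) <= Mall.
  rewrite ge_max; apply/andP; split.
    have [[n nN [x xO <-]] _] := Hbnd.
    by apply: Hall.2; exists n; [exact: PN|exists x => //; exact: bndO].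
  by apply: Hall.2; exists 0%N => //; exists x0.
split => //.
- split; first by exists x0.
  by move=> _ [y yO <-]; apply: x0max; exact: mem_set.
- by rewrite le_max MallC orbT.
(* [MallC] and [CMall] identify [Mall] with the maximum of boundary and initial values. When these
   are all negative, so is [Mall], which is why equality with a maximum that includes 0 is claimed
   under a sign condition. *)
- by move=> C0; rewrite (max_r C0); apply/eqP; rewrite eq_le MallC.
Qed.
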